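(* Let $\beta>0$. Assume that the model $(\mathbb F,\Pi)$ is $\beta$-bounded under $F_\star$ and that $f_\star$ belongs to the KL support of $\Pi$. If the posterior is Hellinger inconsistent (that is, not Hellinger consistent), then there exists $\alpha\in(0,\beta]$ such that the posterior is $(\alpha,\beta)$-inconsistent.
   Context: Setting. $\mathbb X$ is a separable metric space with Borel $\sigma$-algebra $\mathscr X$, $\lambda$ is a $\sigma$-finite measure on it, and $\mathbb F$ is a family of probability densities with respect to $\lambda$ (densities being identified with the distributions they define), equipped with the Borel $\sigma$-algebra $\mathscr F$ of the topology of weak convergence of probability measures. The map $(x,f)\mapsto f(x)$ is jointly measurable on $\mathbb X\times\mathbb F$. $X_1,X_2,\dots$ are iid $\mathbb X$-valued random elements with distribution $F_\star$ having density $f_\star$ with respect to $\lambda$. All probability statements (''almost surely'', etc.) are under the infinite product measure $F_\star^\infty$. The prior $\Pi$ is a probability measure on $(\mathbb F,\mathscr F)$. The likelihood ratio is $R_n(f):=\prod_{i=1}^n f(X_i)/f_\star(X_i)$, and the posterior distributions are $$\Pi(\mathrm df\mid X_{1:n})=\frac{R_n(f)\,\Pi(\mathrm df)}{\int_{\mathbb F}R_n(g)\,\Pi(\mathrm dg)},\qquad n\in\mathbb N.$$ KL support. $\mathrm{KL}(f,g):=\int_{\mathbb X} f\ln(f/g)\,\mathrm d\lambda$. A density $f_\star\in\mathbb F$ belongs to the KL support of $\Pi$ if $\Pi(\{f\in\mathbb F:\mathrm{KL}(f_\star,f)<\delta\})>0$ for all $\delta>0$. Hellinger consistency. $d_h^2(f,g):=\int_{\mathbb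 X}(f^{1/2}-g^{1/2})^2\,\mathrm d\lambda$. The posterior is Hellinger consistent (at $f_\star$) if, for all $\varepsilon>0$, $\lim_{n\to\infty}\Pi(\{f\in\mathbb F:d_h(f,f_\star)>\varepsilon\}\mid X_{1:n})=0$ almost surely. $\beta$-boundedness. For $\beta\ge0$, the model $(\mathbb F,\Pi)$ is $\beta$-bounded under $F_\star$ if $\lim_{n\to\infty}\Pi(\{f\in\mathbb F:R_n(f)>e^{\beta n}\}\mid X_{1:n})=0$ almost surely under $F_\star^\infty$. $(\alpha,\beta)$-inconsistency. For $0<\alpha\le\beta<\infty$, the posterior is $(\alpha,\beta)$-inconsistent if there exists $\delta>0$ such that $$F_\star^\infty\Big(\Pi(\{f\in\mathbb F:e^{\alpha n}\le R_n(f)\le e^{\beta n}\}\mid X_{1:n})>\delta\ \text{ for infinitely many } n\Big)>0.$$ *)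

(* Defs.v *)
From HB Require Import structures.
From mathcomp Require Import all_boot all_order all_algebra finmap.
From mathcomp Require Import all_classical all_reals all_analysis.

Set Implicit Arguments.
Unset Strict Implicit.
Unset Printing Implicit Defensive.

Import Order.TTheory GRing.Theory Num.Theory.
Import numFieldNormedType.Exports.

Local Open Scope classical_set_scope.
Local Open Scope ring_scope.

(* The sigma-algebra and the metric are a priori unrelated; they are tied
   together by the predicate [borel_sigma_algebra] below. *)
#[short(type="measurableMetricType")]
HB.structure Definition MeasurableMetric (d : measure_display) (R : realType) :=
  { T of Measurable d T & Metric R T }.

Definition separable (T : topologicalType) :=
  exists2 D : set T, countable D & dense D.

Definition borel_sigma_algebra d (R : realType)
    (T : measurableMetricType d R) :=
  @measurable d T = <<s @open T >>.

(* A family of densities is a map p : F -> (X -> R); an element f : F stands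
   for the density p f. *)

Definition is_density d (X : measurableType d) (R : realType)
    (lambda : {measure set X -> \bar R}) (f : X -> R) :=
  [/\ measurable_fun [set: X] f, (forall x, 0 <= f x) &
      (\int[lambda]_x (f x)%:E = 1)%E].

(* Densities are identified with the distributions they define: two indices
   whose densities agree lambda-a.e. are equal. *)
Definition density_family d (X : measurableType d) (R : realType)
    (lambda : {measure set X -> \bar R}) (F : Type) (p : F -> X -> R) :=
  (forall f, is_density lambda (p f)) /\
  (forall f g, {ae lambda, forall x, p f x = p g x} -> f = g).

Definition has_density d (X : measurableType d) (R : realType)
    (lambda : {measure set X -> \bar R}) (Q : probability X R) (f : X -> R) :=
  forall A, measurable A -> Q A = (\int[lambda]_(x in A) (f x)%:E)%E.

Definition bounded_continuous (R : realType) (X : topologicalType) : Type :=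
  {phi : X -> R | continuous phi /\ [bounded phi x | x in [set: X]]}.

(* The topology of weak convergence is the coarsest topology on F making
   f |-> \int phi dP_f continuous for every bounded continuous phi, where P_f
   is the distribution with density p f. *)
Definition weak_functional d (R : realType) (X : measurableMetricType d R)
    (lambda : {measure set X -> \bar R}) (F : Type) (p : F -> X -> R) (f : F) :
    {ptws bounded_continuous R X -> R} :=
  fun phi => \int[lambda]_x (sval phi x * p f x).

Definition weak_open d (R : realType) (X : measurableMetricType d R)
    (lambda : {measure set X -> \bar R}) (F : choiceType) (p : F -> X -> R) :
    set (set F) :=
  @open (initial_topology (weak_functional lambda p)).

Definition weak_borel d (R : realType) (X : measurableMetricType d R)
    (lambda : {measure set X -> \bar R}) d' (F : measurableType d')
    (p : F -> X -> R) :=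
  @measurable d' F = <<s weak_open lambda p >>.

Definition jointly_measurable d (X : measurableType d) d'
    (F : measurableType d') (R : realType) (p : F -> X -> R) :=
  measurable_fun [set: X * F] (fun xf : X * F => p xf.2 xf.1).

Definition iid d0 (Omega : measurableType d0) d (X : measurableType d)
    (R : realType) (P : probability Omega R) (Q : probability X R)
    (xi : nat -> {RV P >-> X}) :=
  (forall i A, measurable A -> distribution P (xi i) A = Q A) /\
  (forall (J : {fset nat}) (A : nat -> set X),
     (forall i, measurable (A i)) ->
     P (\bigcap_(i in [set` J]) xi i @^-1` A i) =
       (\prod_(i <- J) P (xi i @^-1` A i))%E).

(* In [\bar R], [0^-1 = +oo], [0 * _ = 0], [lne 0 = -oo] and [lne +oo = +oo],
   so this is the usual convention: the integrand is 0 where f = 0, and +oo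
   where f > 0 = g. *)
Definition KL d (X : measurableType d) (R : realType)
    (lambda : {measure set X -> \bar R}) (f g : X -> R) : \bar R :=
  (\int[lambda]_x ((f x)%:E * lne ((f x)%:E / (g x)%:E)))%E.

Definition hellinger d (X : measurableType d) (R : realType)
    (lambda : {measure set X -> \bar R}) (f g : X -> R) : R :=
  Num.sqrt (\int[lambda]_x (Num.sqrt (f x) - Num.sqrt (g x)) ^+ 2).

(* Observations are numbered from 0: [x 0] is the first one.  Division by
   zero yields 0, which only matters on the null event that the true density
   fs vanishes at some observation. *)
Definition likelihood_ratio (X F : Type) (R : realType) (p : F -> X -> R)
    (fs : F) (x : nat -> X) (n : nat) (f : F) : R :=
  \prod_(i < n) (p f (x i) / p fs (x i)).

Definition posterior (X : Type) d' (F : measurableType d') (R : realType)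
    (Pi : probability F R) (p : F -> X -> R) (fs : F) (x : nat -> X) (n : nat)
    (A : set F) : R :=
  (\int[Pi]_(f in A) likelihood_ratio p fs x n f) /
  (\int[Pi]_f likelihood_ratio p fs x n f).

Definition KL_support d (X : measurableType d) d' (F : measurableType d')
    (R : realType) (lambda : {measure set X -> \bar R}) (Pi : probability F R)
    (p : F -> X -> R) (fs : F) :=
  forall delta : R, 0 < delta ->
    (0 < Pi [set f | KL lambda (p fs) (p f) < delta%:E])%E.

(* The observations are random elements xi of X on a probability space
   (Omega, P).  When they are iid, the infinite product measure is the law of
   the sequence (xi i)_i under P, so that an event about the observations has
   the same probability under both. *)

Definition hellinger_consistent d0 (Omega : measurableType d0) d
    (X : measurableType d) d' (F : measurableType d') (R : realType)
    (P : probability Omega R) (xi : nat -> {RV P >-> X})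
    (lambda : {measure set X -> \bar R}) (Pi : probability F R)
    (p : F -> X -> R) (fs : F) :=
  forall eps : R, 0 < eps ->
    {ae P, forall w,
      posterior Pi p fs (fun i => xi i w) n
        [set f | eps < hellinger lambda (p f) (p fs)] @[n --> \oo] --> (0 : R)}.

Definition beta_bounded d0 (Omega : measurableType d0) d
    (X : measurableType d) d' (F : measurableType d') (R : realType)
    (P : probability Omega R) (xi : nat -> {RV P >-> X}) (Pi : probability F R)
    (p : F -> X -> R) (fs : F) (beta : R) :=
  {ae P, forall w,
    posterior Pi p fs (fun i => xi i w) n
      [set f | expR (beta * n%:R) <
               likelihood_ratio p fs (fun i => xi i w) n f]
      @[n --> \oo] --> (0 : R)}.

(* [lim_sup_set E] is the event that E n happens for infinitely many n. *)
Definition inconsistent d0 (Omega : measurableType d0) d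
    (X : measurableType d) d' (F : measurableType d') (R : realType)
    (P : probability Omega R) (xi : nat -> {RV P >-> X}) (Pi : probability F R)
    (p : F -> X -> R) (fs : F) (alpha beta : R) :=
  exists2 delta : R, 0 < delta &
    let E n := [set w : Omega |
      delta < posterior Pi p fs (fun i => xi i w) n
        [set f | expR (alpha * n%:R) <=
                 likelihood_ratio p fs (fun i => xi i w) n f <=
                 expR (beta * n%:R)]] in
    (0 < P (lim_sup_set E))%E.

(* Main.v *)
Require Import Defs.
From HB Require Import structures.
From mathcomp Require Import all_boot all_order all_algebra finmap.
From mathcomp Require Import all_classical all_reals all_analysis.
From mathcomp Require Import measurable_realfun ring lra.

Set Implicit Arguments.
Unset Strict Implicit.
Unset Printing Implicit Defensive.

Import Order.TTheory GRing.Theory Num.Theory.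
Import numFieldNormedType.Exports.

Local Open Scope classical_set_scope.
Local Open Scope ring_scope.

(** Fix [eps > 0] and let A be the set of densities at Hellinger distance more
    than [eps] from the true one.  Write D n for the evidence, i.e. the
    integral of the likelihood ratio R n against the prior.  The claim is that
    the part of A where [R n < exp (alpha n)] has vanishing posterior
    probability as soon as [0 < alpha <= eps^2 / 2].  Since the model is
    [beta]-bounded, a posterior mass of A that does not vanish must then stay,
    infinitely often and with positive probability, on the densities with
    [exp (alpha n) <= R n <= exp (beta n)]; this is the asserted inconsistency
    for [alpha = min beta (eps^2 / 2)].

    Numerator ([integral_root], [root_vanish]).  Where [R n < exp (alpha n)],
    R n is at most [exp (alpha n / 2)] times its square root.  By independence
    the expected square root is the n-th power of the Hellinger affinity, hence
    at most [exp (- eps^2 n / 2)] on A ([iid_prod], [integral_affinity]).  By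
    Tonelli the prior average over A obeys the same bound, and multiplied by
    [exp (c n)] with [c < eps^2 / 2] it has summable expectations, so it tends
    to 0 almost surely.

    Denominator ([evidence_lower_bound]).  Almost surely D n is eventually at
    least a positive constant times [exp (- c n)], for every [c > 0].  On a
    small KL ball B around the true density the positive part g of the log
    ratio of the true density to f has a small mean a, uniformly in f
    ([integral_neg_log_le]).  A factor may be lost between a and c, so that a
    crude one-sided law of large numbers is enough: at the dyadic times
    [N = 2 ^ k], the sum of g over the first N observations exceeds [2 a N]
    with probabilities that are summable over k, with a bound that only
    depends on a ([iid_dyadic_series], by truncation at N and Chebyshev's
    inequality).  Because that bound is uniform over B, it can be integrated
    over B: the prior mass of the densities of B that are bad at the k-th scale
    has summable expectation, and tends to 0 almost surely.  So eventually at
    least half of the mass of B is good, and on that half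
    [R n >= exp (- 4 a n)] by monotonicity between dyadic times.

    The evidence is not shown to be finite: where it is infinite, [posterior]
    vanishes by convention, which is harmless for an upper bound. *)

(** * Integration against a law given by a density *)

Section weighted_integral.
Context d (T : measurableType d) d' (X : measurableType d') (R : realType).
Variables (mu : {measure set T -> \bar R}) (Q : {measure set X -> \bar R}).
Variables (Z : T -> R) (Y : T -> X) (c : R).
Hypothesis mZ : measurable_fun setT Z.
Hypothesis Z0 : forall t, 0 <= Z t.
Hypothesis mY : measurable_fun setT Y.
Hypothesis HZ : forall A, measurable A ->
  (\int[mu]_t ((Z t)%:E * (\1_A (Y t))%:E) = c%:E * Q A)%E.

Import HBNNSimple.

(** Used in two ways: with [Y] the identity, to integrate against the measure
    of density [Z]; and with [Y] one term of an iid sequence and [Z] a product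
    over the other terms, to pull a factor out of an expectation. *)
Lemma ge0_integral_weighted (g : X -> \bar R) :
  measurable_fun setT g -> (forall x, 0 <= g x)%E ->
  (\int[mu]_t ((Z t)%:E * g (Y t)) = c%:E * \int[Q]_x g x)%E.
Proof.
move=> mg g0.
have mZE : measurable_fun setT (EFin \o Z) by exact/measurable_EFinP.
pose g_ := nnsfun_approx measurableT mg.
have cg x : EFin (g_ n x) @[n --> \oo] --> g x by exact: cvg_nnsfun_approx.
have ndg x : {homo (fun n => (g_ n x)%:E) : m n / (m <= n)%N >-> (m <= n)%E}.
  by move=> m n mn; rewrite lee_fin; exact/lefP/nd_nnsfun_approx.
have mgn n : measurable_fun setT (fun x => (g_ n x)%:E).
  exact/measurable_EFinP.
have mind (A : set X) : measurable A ->
    measurable_fun setT (fun t => (\1_A (Y t))%:E : \bar R).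
  move=> mA; apply/measurable_EFinP.
  exact: (measurableT_comp (measurable_indic mA) mY).
have step n : (\int[mu]_t ((Z t)%:E * (g_ n (Y t))%:E) =
    c%:E * \int[Q]_x (g_ n x)%:E)%E.
  rewrite integralT_nnsfun sintegralE.
  have E t : ((Z t)%:E * (g_ n (Y t))%:E = \sum_(r \in range (g_ n))
      ((Z t)%:E * (r * \1_(g_ n @^-1` [set r]) (Y t))%:E))%E.
    rewrite fimfunE -fsumEFin// ge0_mule_fsumr// => r.
    by rewrite EFinM nnfun_muleindic_ge0.
  under eq_integral => t _ do rewrite E.
  rewrite ge0_integral_fsum//; last 2 first.
  - move=> r; apply: emeasurable_funM; first exact: mZE.
    apply/measurable_EFinP/measurable_funM => //; apply/measurable_EFinP; exact: mind.
  - move=> r t _; apply: mule_ge0; first by rewrite lee_fin; exact: Z0.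
    by rewrite EFinM nnfun_muleindic_ge0.
  rewrite ge0_mule_fsumr; last exact: nnsfun_mulemu_ge0.
  apply: eq_fsbigr => r; rewrite inE => -[x _ <-].
  under eq_integral => t _ do rewrite EFinM muleCA.
  rewrite ge0_integralZl//.
  - by rewrite HZ// muleCA.
  - by apply: emeasurable_funM; [exact: mZE|exact: mind].
  - by move=> t _; apply: mule_ge0; rewrite lee_fin ?Z0.
  - by rewrite lee_fin.
have lZ : (\int[mu]_t ((Z t)%:E * (g_ n (Y t))%:E))%E @[n --> \oo] -->
          (\int[mu]_t ((Z t)%:E * g (Y t)))%E.
  have -> : (\int[mu]_t ((Z t)%:E * g (Y t)) =
      \int[mu]_t limn (fun n => (Z t)%:E * (g_ n (Y t))%:E))%E.
    apply: eq_integral => t _; apply/esym/cvg_lim => //.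
    exact: cvgeZl.
  apply: cvg_monotone_convergence => //.
  - move=> k; apply: emeasurable_funM; first exact: mZE.
    exact: measurableT_comp (mgn k) mY.
  - by move=> k t _; apply: mule_ge0; rewrite lee_fin ?Z0.
  - by move=> t _ k l kl; apply: lee_wpmul2l; [rewrite lee_fin|exact: ndg].
have lQ : (\int[mu]_t ((Z t)%:E * (g_ n (Y t))%:E))%E @[n --> \oo] -->
          (c%:E * \int[Q]_x g x)%E.
  under eq_fun do rewrite step.
  apply: cvgeZl => //.
  have -> : (\int[Q]_x g x = \int[Q]_t limn (fun n => (g_ n t)%:E))%E.
    by apply: eq_integral => t _; apply/esym/cvg_lim.
  apply: cvg_monotone_convergence => //.
  by move=> k t _; rewrite lee_fin.
exact: cvg_unique lZ lQ.
Qed.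
End weighted_integral.

(** * Expectations of products over an iid sequence *)

Section iid_product.
Context d (T : measurableType d) d' (X : measurableType d') (R : realType).
Variables (P : probability T R) (Q : probability X R).
Variable xi : nat -> {RV P >-> X}.
Hypothesis xi_iid : iid Q xi.

Let iid_prod_indic (n : nat) (A : nat -> set X) :
  (forall i, measurable (A i)) ->
  (\int[P]_w (\prod_(i < n) \1_(A i) (xi i w))%:E =
   (\prod_(i < n) fine (Q (A i)))%:E)%E.
Proof.
move=> mA; case: xi_iid => xiQ xiI.
pose J := [fset i in iota 0 n]%fset.
have Jn (h : nat -> \bar R) : (\prod_(i <- J) h i = \prod_(i < n) h i)%E.
  rewrite -(big_mkord xpredT) /index_iota subn0; apply: perm_big.
  apply: uniq_perm; rewrite ?fset_uniq ?iota_uniq// => i.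
  by rewrite !inE.
have mpre i : measurable (xi i @^-1` A i).
  by rewrite -[_ @^-1` _]setTI; exact: measurable_funP.
transitivity (P (\bigcap_(i in [set` J]) xi i @^-1` A i)).
  rewrite -[X in _ = P X]setIT -integral_indic//; last first.
    by apply: fin_bigcap_measurable => //; exact: finite_fset.
  apply: eq_integral => w _; congr EFin.
  rewrite indicE; case: (boolP (w \in _)); rewrite ?inE ?notin_setE.
    move=> wA; rewrite big1// => i _; rewrite indicE mem_set//.
    by apply: wA => /=; rewrite !inE mem_iota/= add0n.
  move=> wA; have [i [iJ /= nA]] : exists i, i \in J /\ ~ A i (xi i w).
    apply: contrapT => /forallNP H; apply: wA => i /= iJ.
    by apply: contrapT => nA; apply: (H i).
  move: iJ; rewrite !inE mem_iota/= add0n => iln.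
  rewrite (bigD1 (Ordinal iln))//= indicE memNset ?mul0r//.
rewrite xiI// Jn -prodEFin; apply: eq_bigr => i _.
have -> : P (xi i @^-1` A i) = Q (A i) by rewrite -(xiQ i).
by rewrite fineK// fin_num_measure.
Qed.

(** Induction on the number [k] of factors that are not indicators.  With the
    other factors fixed, the expectation is, as a function of the event tested
    by the factor of index [k], a multiple of [Q]; hence that factor may be any
    nonnegative function. *)
Let iid_prod_aux (k n : nat) (g : nat -> X -> R) (A : nat -> set X)
    (m : nat -> R) :
  (forall i, measurable_fun setT (g i)) -> (forall i x, 0 <= g i x) ->
  (forall i, \int[Q]_x (g i x)%:E = (m i)%:E)%E ->
  (forall i, measurable (A i)) ->
  (forall i, (k <= i)%N -> g i = \1_(A i)) ->
  (\int[P]_w (\prod_(i < n) g i (xi i w))%:E = (\prod_(i < n) m i)%:E)%E.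
Proof.
elim: k g A m => [|k IH] g A m mg g0 gm mA gA.
  under eq_integral => w _ do under eq_bigr => i _ do rewrite gA//.
  rewrite iid_prod_indic//; congr EFin; apply: eq_bigr => i _.
  by have := gm i; rewrite gA// integral_indic// setIT => ->.
have m0 i : 0 <= m i.
  by rewrite -lee_fin -gm; apply: integral_ge0 => x _; rewrite lee_fin.
have upd (B : set X) (mB : measurable B) :
  (\int[P]_w (\prod_(i < n) (if i == k :> nat then \1_B (xi i w) else g i (xi i w)))%:E =
   (\prod_(i < n) (if i == k :> nat then fine (Q B) else m i))%:E)%E.
  pose g' i := if i == k then \1_B else g i.
  have := IH g' (fun i => if i == k then B else A i)
     (fun i => if i == k then fine (Q B) else m i).
  rewrite /g' => <-.
  - by apply: eq_integral => w _; congr EFin; apply: eq_bigr => i _; case: ifPn.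
  - by move=> i; case: ifPn => // _; exact: measurable_indic.
  - by move=> i x; case: ifPn => // _.
  - move=> i; case: ifPn => // _.
    by rewrite integral_indic// setIT fineK// fin_num_measure.
  - by move=> i; case: ifPn.
  - move=> i ki; case: ifPn => // ik; apply: gA.
    by rewrite ltn_neqAle eq_sym ik.
have [kn|nk] := ltnP k n; last first.
  have ik (i : 'I_n) : (i == k :> nat) = false.
    by rewrite ltn_eqF//; exact: leq_trans (ltn_ord i) nk.
  have -> : \prod_(i < n) m i =
      \prod_(i < n) (if i == k :> nat then fine (Q setT) else m i).
    by apply: eq_bigr => i _; rewrite ik.
  rewrite -upd//.
  apply: eq_integral => w _; congr EFin; apply: eq_bigr => i _.
  by rewrite ik.
pose ko := Ordinal kn.
pose Z w := \prod_(i < n | i != ko) g i (xi i w).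
pose c := \prod_(i < n | i != ko) m i.
have H B : measurable B ->
    (\int[P]_w ((Z w)%:E * (\1_B (xi k w))%:E) = c%:E * Q B)%E.
  move=> mB; have := upd B mB; rewrite (bigD1 ko)//= eqxx.
  under eq_integral => w _ do rewrite (bigD1 ko)//= eqxx.
  rewrite EFinM fineK ?fin_num_measure// muleC => E.
  transitivity (Q B * c%:E)%E; last by rewrite muleC.
  rewrite muleC in E.
  rewrite [c](eq_bigr (fun i : 'I_n => if i == k :> nat then fine (Q B) else m i)) -?E.
    apply: eq_integral => w _; rewrite -EFinM mulrC; congr (_ * _)%:E.
    by apply: eq_bigr => i ik; rewrite ifN// (_ : _ == _ = (i == ko)).
  by move=> i ik; rewrite ifN// (_ : _ == _ = (i == ko)).
have -> : \prod_(i < n) m i = c * m k by rewrite (bigD1 ko)//= mulrC.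
rewrite EFinM -gm.
have mZ : measurable_fun setT Z.
  rewrite /Z; under eq_fun do rewrite big_mkcond/=.
  apply: measurable_prod => i _; case: (i != ko) => //.
  exact: measurableT_comp.
have Z0 w : 0 <= Z w by apply: prodr_ge0.
rewrite -(@ge0_integral_weighted _ T _ X R P Q Z (xi k) c mZ Z0 _ H
  (EFin \o g k))//.
- by apply: eq_integral => w _; rewrite (bigD1 ko)//= mulrC EFinM.
- exact/measurable_EFinP.
- by move=> x; rewrite lee_fin.
Qed.

Lemma iid_prod (n : nat) (g : nat -> X -> R) (m : nat -> R) :
  (forall i, measurable_fun setT (g i)) -> (forall i x, 0 <= g i x) ->
  (forall i, \int[Q]_x (g i x)%:E = (m i)%:E)%E ->
  (\int[P]_w (\prod_(i < n) g i (xi i w))%:E = (\prod_(i < n) m i)%:E)%E.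
Proof.
move=> mg g0 gm.
pose g' i := if (i < n)%N then g i else \1_setT.
have := @iid_prod_aux n n g' (fun=> setT)
  (fun i => if (i < n)%N then m i else 1).
rewrite /g' => H.
transitivity (\int[P]_w (\prod_(i < n)
    (if (i < n)%N then g i else \1_setT) (xi i w))%:E)%E.
  apply: eq_integral => w _; congr EFin; apply: eq_bigr => i _.
  by rewrite ltn_ord.
rewrite H.
- by congr EFin; apply: eq_bigr => i _; rewrite ltn_ord.
- by move=> i; case: ifPn => // _; exact: measurable_indic.
- by move=> i x; case: ifPn => // _.
- move=> i; case: ifPn => // _.
  by rewrite integral_indic// setIT; exact: probability_setT.
- by [].
- by move=> i; rewrite ltnNge => ->.
Qed.

End iid_product.

(** * Real inequalities, measurability and summable expectations *)

Section real_bounds.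
Context (R : realType).

(** The terms grow like [2 ^ k] up to the scale of [w] and then decay like
    [w ^ 2 / 2 ^ k].  In the recursion [SS], the linear bound needs the slack
    [- 1] of [S4] to absorb the head term; [S4] starts where the quadratic bound
    [S2] stops being useful. *)
Lemma sum_dyadic_min_sqr (K : nat) (w : R) : 0 <= w ->
  \sum_(k < K) Num.min w (2 ^+ k) ^+ 2 / 2 ^+ k <= 4 * w.
Proof.
pose S K (w : R) := \sum_(k < K) Num.min w (2 ^+ k) ^+ 2 / 2 ^+ k.
have SS k v : S k.+1 v = Num.min v 1 ^+ 2 + 2 * S k (v / 2).
  rewrite /S big_ord_recl expr0 divr1; congr (_ + _).
  rewrite mulr_sumr; apply: eq_bigr => i _; rewrite lift0.
  have -> : Num.min v (2 ^+ i.+1) = 2 * Num.min (v / 2) (2 ^+ i).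
    by rewrite minr_pMr// -exprS mulrCA divff// mulr1.
  have : (2 ^+ i : R) != 0 by rewrite expf_neq0.
  rewrite (exprS 2 i); move: (2 ^+ i) (Num.min (v / 2) (2 ^+ i)) => b a b0.
  by field.
have S2 k v : 0 <= v -> S k v <= 2 * v ^+ 2.
  elim: k v => [|k IH] v v0; first by rewrite /S big_ord0 mulr_ge0// sqr_ge0.
  have v20 : 0 <= v / 2 by rewrite divr_ge0.
  rewrite SS; have := IH _ v20.
  have : Num.min v 1 ^+ 2 <= v ^+ 2.
    by rewrite lerXn2r ?nnegrE ?le_min ?v0 ?ler01// ge_min lexx.
  nra.
have S4 k v : 1 <= v -> S k v <= 4 * v - 1.
  elim: k v => [|k IH] v v1; first by rewrite /S big_ord0; lra.
  rewrite SS min_r// expr1n.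
  have [v2|v2] := leP 2 v.
    have := IH (v / 2); lra.
  have := S2 k (v / 2); nra.
move=> w0; have [w1|w1] := leP 1 w; first by have := S4 K w w1; rewrite /S; lra.
by have := S2 K w w0; rewrite /S; nra.
Qed.

(** When [r = expR (- y)] is a likelihood ratio, its mean is at most 1, so that
    [y - 1 + expR (- y)] has at most the mean of [y], the relative entropy; and
    unlike [y] it is nonnegative.  It dominates [y / 2] for [2 < y], and
    [y ^ 2 / 4] for [0 < y <= 2], where [eta] pays for the loss. *)
Lemma maxr0_le_entropy (eta y : R) : 0 < eta ->
  Num.max 0 y <= (2 + eta^-1) * (y - 1 + expR (- y)) + eta.
Proof.
move=> eta0.
have e0 : 0 < eta^-1 by rewrite invr_gt0.
have W0 : 0 <= y - 1 + expR (- y) by have := expR_ge1Dx (- y); lra.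
have [y0|y0] := leP y 0.
  by apply: addr_ge0; [apply: mulr_ge0 => //; lra|exact: ltW].
have [y2|y2] := leP y 2.
  have W : y ^+ 2 / 4 <= y - 1 + expR (- y).
    have -> : expR (- y) = expR (- y / 2) ^+ 2.
      by rewrite -expRM_natl; congr expR; field.
    have := expR_ge1Dx (- y / 2); have : 0 <= 1 + - y / 2 by lra.
    nra.
  have : y <= eta + eta^-1 * (y ^+ 2 / 4).
    rewrite -subr_ge0 (_ : _ - _ = eta^-1 * (eta - y / 2) ^+ 2); last first.
      by field; rewrite gt_eqF.
    by rewrite mulr_ge0 ?sqr_ge0// ltW.
  have : eta^-1 * (y ^+ 2 / 4) <= eta^-1 * (y - 1 + expR (- y)).
    by rewrite ler_pM2l.
  nra.
have := expR_gt0 (- y); nra.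
Qed.

(** Positive part of [- ln r]; it is infinite at a vanishing ratio [r], so that
    [expRN_le_prod] needs no exceptional null set. *)
Definition neg_log (r : R) : \bar R :=
  if r <= 0 then +oo%E else (Num.max 0 (- ln r))%:E.

Lemma neg_log_ge0 r : (0 <= neg_log r)%E.
Proof. by rewrite /neg_log; case: ifP => // _; rewrite lee_fin le_max lexx. Qed.

Lemma expRN_le_prod (n : nat) (r : nat -> R) (y : R) : (forall i, 0 <= r i) ->
  (\sum_(i < n) neg_log (r i) <= y%:E)%E -> expR (- y) <= \prod_(i < n) r i.
Proof.
move=> r0; elim: n y => [|n IH] y.
  rewrite !big_ord0 lee_fin => y0.
  by rewrite -[leRHS]expR0 ler_expR oppr_le0.
rewrite !big_ord_recr/= {2}/neg_log.
have s0 : (0 <= \sum_(i < n) neg_log (r i))%E.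
  by apply: sume_ge0 => i _; exact: neg_log_ge0.
case: ifPn => [_|]; first by rewrite addey// gt_eqF// (lt_le_trans _ s0).
rewrite -ltNge => rn0; set m := Num.max 0 _.
rewrite -leeBrDr// => /IH{}IH.
apply: le_trans (ler_pM _ _ IH (_ : expR (- m) <= _)).
- rewrite -expRD (_ : - y = - (y - m) + - m)//; ring.
- exact: expR_ge0.
- exact: expR_ge0.
- by rewrite -[leRHS]lnK ?posrE// ler_expR lerNl le_max lexx orbT.
Qed.

Lemma measurable_neg_log d (T : measurableType d) (u : T -> R) :
  measurable_fun setT u -> measurable_fun setT (fun t => neg_log (u t)).
Proof.
move=> mu; apply: measurable_fun_ifT => //.
  exact: measurable_fun_ler.
apply/measurable_EFinP; apply: measurable_maxr => //.
apply: measurable_funN; exact: measurableT_comp.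
Qed.

Lemma measurable_sqrt : measurable_fun setT (@Num.sqrt R).
Proof. by apply: continuous_measurable_fun; exact: sqrt_continuous. Qed.

Lemma measurable_invr : measurable_fun setT (@GRing.inv R).
Proof.
have -> : @GRing.inv R = fun x => if x == 0 then 0 else x^-1.
  by apply/funext => x; case: eqP => // ->; rewrite invr0.
apply: measurable_fun_if => //.
- exact: measurable_fun_eqr.
- apply: (measurable_funS (E := [set x : R | x != 0])).
  + by apply: open_measurable; exact: open_neq.
  + by move=> x [_] /= /negbT.
  + apply: open_continuous_measurable_fun; first exact: open_neq.
    by move=> x; rewrite inE; exact: inv_continuous.
Qed.

Lemma measurable_set_ltr d (T : measurableType d) (u v : T -> R) :
  measurable_fun setT u -> measurable_fun setT v ->
  measurable [set t | u t < v t].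
Proof.
move=> mu mv; rewrite -[X in measurable X]setTI.
exact: (measurable_fun_ltr mu mv measurableT (Y := [set true])).
Qed.

Lemma measurable_set_ler d (T : measurableType d) (u v : T -> R) :
  measurable_fun setT u -> measurable_fun setT v ->
  measurable [set t | u t <= v t].
Proof.
move=> mu mv; rewrite -[X in measurable X]setTI.
exact: (measurable_fun_ler mu mv measurableT (Y := [set true])).
Qed.

End real_bounds.

Section vanishing.
Context d (T : measurableType d) (R : realType) (mu : {measure set T -> \bar R}).

Lemma ae_cvg0_summable_integral (u : nat -> T -> \bar R) :
  (forall n, measurable_fun setT (u n)) -> (forall n t, 0 <= u n t)%E ->
  (\sum_(n <oo) \int[mu]_t u n t < +oo)%E ->
  {ae mu, forall t, u n t @[n --> \oo] --> 0%E}.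
Proof.
move=> mu_ u0; rewrite -integral_nneseries// => sfin.
have s0 t : (0 <= \sum_(n <oo) u n t)%E by exact: nneseries_ge0.
have : mu.-integrable setT (fun t => \sum_(n <oo) u n t)%E.
  apply/integrableP; split; first exact: ge0_emeasurable_sum.
  by under eq_integral => t _ do rewrite gee0_abs//.
move/integrable_ae => /(_ measurableT); apply: filterS => t /(_ I).
rewrite ge0_fin_numE// => /nneseries_tail_cvg/(_ (fun k _ => u0 k t)) tl.
apply: squeeze_cvge tl; last exact: cvg_cst.
apply: nearW => n; rewrite u0/=.
have := @nneseries_lim_ge R (u^~ t) xpredT n n.+1 (fun k _ _ => u0 k t).
by rewrite big_nat1.
Qed.

End vanishing.

(** * A one-sided law of large numbers along dyadic times *)

Lemma integral_cst_probability d (T : measurableType d) (R : realType)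
  (P : probability T R) (c : \bar R) : (\int[P]_w cst c w = c)%E.
Proof.
rewrite integral_cst// -[RHS]mule1; congr (_ * _)%E; exact: probability_setT.
Qed.

Section iid_dyadic_bound.
Context d (T : measurableType d) d' (X : measurableType d') (R : realType).
Variables (P : probability T R) (Q : probability X R).
Variable xi : nat -> {RV P >-> X}.
Hypothesis xi_iid : iid Q xi.

Let eq_ler (x y : R) : x = y -> x <= y. Proof. by move=> ->. Qed.

Let sum_cst (c : R) n : (\sum_(i < n) c%:E = (n%:R * c)%:E)%E.
Proof. by rewrite sumEFin sumr_const card_ord mulr_natl. Qed.

Let iid_integral (h : X -> \bar R) i :
  measurable_fun setT h -> (forall x, 0 <= h x)%E ->
  (\int[P]_w h (xi i w) = \int[Q]_x h x)%E.
Proof.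
move=> mh h0; rewrite -(ge0_integral_distribution (xi i))//.
by apply: eq_measure_integral => A mA _; case: xi_iid => + _; exact.
Qed.

Let iid_pair (u : X -> R) (m : R) (i j n : nat) :
  measurable_fun setT u -> (forall x, 0 <= u x) ->
  (\int[Q]_x (u x)%:E = m%:E)%E -> (i < n)%N -> (j < n)%N -> i != j ->
  (\int[P]_w (u (xi i w) * u (xi j w))%:E = (m ^+ 2)%:E)%E.
Proof.
move=> mu u0 um iltn jltn ij.
pose io := Ordinal iltn; pose jo := Ordinal jltn.
have prod2 (h : nat -> R) : \prod_(l < n)
    (if (l == i :> nat) || (l == j :> nat) then h l else 1) = h i * h j.
  rewrite (bigD1 io)//= eqxx/= (bigD1 jo)/=; last first.
    by rewrite -val_eqE/= eq_sym.
  rewrite eqxx orbT/= big1 ?mulr1// => l /andP[li lj].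
  by rewrite ifN// negb_or; apply/andP; split.
have := iid_prod xi_iid n
  (g := fun l => if (l == i) || (l == j) then u else cst 1)
  (m := fun l => if (l == i) || (l == j) then m else 1).
rewrite (prod2 (fun=> m)) -expr2 => <-.
- apply: eq_integral => w _; rewrite -(prod2 (fun l => u (xi l w))).
  by congr EFin; apply: eq_bigr => l _; case: ifP.
- by move=> l; case: ifP.
- by move=> l x; case: ifP.
- move=> l; case: ifP => // _.
  exact: (integral_cst_probability Q 1%:E).
Qed.

(** Chebyshev's inequality for the sum of the terms truncated at [n], whose mean
    is at most [a * n].  A term above [n] is charged to its own truncated
    square, so that the truncated second moment controls both events. *)
Lemma iid_truncation_bound (g : X -> \bar R) (a : R) (n : nat) :
  measurable_fun setT g -> (forall x, 0 <= g x)%E -> 0 < a -> (0 < n)%N ->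
  (\int[Q]_x g x <= a%:E)%E ->
  (P [set w | (2 * a * n%:R)%:E < \sum_(i < n) g (xi i w)] <=
   (1 + a ^- 2)%:E *
   \int[Q]_x (fine (mine (g x) n%:R%:E) ^+ 2 / n%:R)%:E)%E.
Proof.
move=> mg g0 a0 n0 ga.
pose u x := fine (mine (g x) n%:R%:E).
have uE x : (u x)%:E = mine (g x) n%:R%:E.
  have m0 : (0 <= mine (g x) n%:R%:E)%E by rewrite le_min g0 lee_fin ler0n.
  rewrite /u fineK// ge0_fin_numE//.
  by apply: (@le_lt_trans _ _ n%:R%:E); rewrite ?ltry// ge_min lexx orbT.
have u0 x : 0 <= u x by rewrite -lee_fin uE le_min g0 lee_fin ler0n.
have un x : u x <= n%:R by rewrite -lee_fin uE ge_min lexx orbT.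
have ug x : ((u x)%:E <= g x)%E by rewrite uE ge_min lexx.
have mu : measurable_fun setT u.
  apply: (measurableT_comp (fine_measurable _)) => //.
  by apply: measurable_mine.
have mui i : measurable_fun setT (fun w => u (xi i w)) by exact: measurableT_comp.
have nR : 0 < n%:R :> R by rewrite ltr0n.
have fin (h : X -> R) (c : R) : measurable_fun setT h -> (forall x, 0 <= h x <= c) ->
    exists2 m : R, 0 <= m & (\int[Q]_x (h x)%:E = m%:E)%E.
  move=> mh hc.
  have I0 : (0 <= \int[Q]_x (h x)%:E)%E.
    by apply: integral_ge0 => x _; rewrite lee_fin; case/andP: (hc x).
  exists (fine (\int[Q]_x (h x)%:E)); first exact: fine_ge0.
  rewrite fineK// ge0_fin_numE//.
  apply: (@le_lt_trans _ _ (\int[Q]_x (cst c%:E) x)%E).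
    apply: ge0_le_integral => //.
    - by move=> x _; rewrite lee_fin; case/andP: (hc x).
    - exact/measurable_EFinP.
    - by move=> x _; rewrite lee_fin; case/andP: (hc x).
  by rewrite integral_cst_probability ltry.
have [m m0 um] : exists2 m : R, 0 <= m & (\int[Q]_x (u x)%:E = m%:E)%E.
  by apply: (fin _ n%:R) => // x; rewrite u0 un.
have [v v0 uv] : exists2 v : R, 0 <= v & (\int[Q]_x (u x ^+ 2)%:E = v%:E)%E.
  apply: (fin _ (n%:R ^+ 2)) => [|x]; first exact: measurable_funX.
  by rewrite sqr_ge0/= lerXn2r ?nnegrE.
have ma : m <= a.
  rewrite -lee_fin -um (le_trans _ ga)//; apply: ge0_le_integral => //.
  - by move=> x _; rewrite lee_fin.
  - exact/measurable_EFinP.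
pose S w := \sum_(i < n) u (xi i w).
have S0 w : 0 <= S w by apply: sumr_ge0.
have mS : measurable_fun setT S by exact: measurable_sum.
have ES : (\int[P]_w (S w)%:E = (n%:R * m)%:E)%E.
  under eq_integral => w _ do rewrite /S -sumEFin.
  rewrite ge0_integral_sum//; last 2 first.
  - by move=> i; exact/measurable_EFinP.
  - by move=> i w _; rewrite lee_fin.
  rewrite (eq_bigr (fun=> m%:E)) => [|i _].
    by rewrite sum_cst.
  rewrite (@iid_integral (EFin \o u))//; first exact/measurable_EFinP.
have ES2 : (\int[P]_w (S w ^+ 2)%:E <= (n%:R * v + (n%:R * m) ^+ 2)%:E)%E.
  have S2 w : ((S w ^+ 2)%:E = \sum_(i < n) \sum_(j < n) (u (xi i w) * u (xi j w))%:E)%E.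
    rewrite expr2 /S mulr_suml -sumEFin; apply: eq_bigr => i _.
    by rewrite mulr_sumr -sumEFin.
  under eq_integral => w _ do rewrite S2.
  have muu (i j : nat) : measurable_fun setT (fun w => (u (xi i w) * u (xi j w))%:E).
    by apply/measurable_EFinP; exact: measurable_funM.
  rewrite ge0_integral_sum//; last 2 first.
  - by move=> i; apply: emeasurable_sum => j.
  - by move=> i w _; apply: sume_ge0 => j _; rewrite lee_fin mulr_ge0.
  apply: (@le_trans _ _ (\sum_(i < n) (v + n%:R * m ^+ 2)%:E)%E); last first.
    rewrite sum_cst lee_fin.
    by apply: eq_ler; ring.
  apply: lee_sum => i _.
  rewrite ge0_integral_sum//; last first.
    by move=> j w _; rewrite lee_fin mulr_ge0.
  rewrite (bigD1 i)//= EFinD; apply: leeD.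
    under eq_integral => w _ do rewrite -expr2.
    rewrite (@iid_integral (fun x => (u x ^+ 2)%:E)) ?uv//.
      by apply/measurable_EFinP; exact: measurable_funX.
    by move=> x; rewrite lee_fin sqr_ge0.
  rewrite (eq_bigr (fun=> (m ^+ 2)%:E)) => [|j ji]; last first.
    by rewrite (@iid_pair u m i j n)//; rewrite eq_sym.
  rewrite sumEFin lee_fin sumr_const -[leLHS]mulr_natl ler_wpM2r ?sqr_ge0//.
  by rewrite ler_nat (leq_trans (max_card _))// card_ord.
pose V w := (S w - n%:R * m) ^+ 2.
have mV : measurable_fun setT V.
  by apply: measurable_funX; exact: measurable_funB.
(* [S ^ 2 + (n m) ^ 2 = V + 2 n m S] has only nonnegative terms, so that it can
   be integrated without integrability conditions. *)
have EV : (\int[P]_w (V w)%:E <= (n%:R * v)%:E)%E.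
  have E : (\int[P]_w (S w ^+ 2)%:E + ((n%:R * m) ^+ 2)%:E =
      \int[P]_w (V w)%:E + (2 * (n%:R * m) ^+ 2)%:E)%E.
    transitivity (\int[P]_w ((S w ^+ 2)%:E + (cst ((n%:R * m) ^+ 2)%:E) w))%E.
      rewrite ge0_integralD//.
      - by rewrite integral_cst_probability.
      - by move=> w _; rewrite lee_fin sqr_ge0.
      - by apply/measurable_EFinP; exact: measurable_funX.
      - by move=> w _; rewrite lee_fin sqr_ge0.
    transitivity (\int[P]_w ((V w)%:E + (2 * (n%:R * m))%:E * (S w)%:E))%E.
      apply: eq_integral => w _; rewrite -EFinM -!EFinD /V /=; congr EFin; ring.
    have nm0 : 0 <= 2 * (n%:R * m) by rewrite !mulr_ge0// ltW.
    rewrite ge0_integralD//.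
    - rewrite ge0_integralZl//.
      + by rewrite ES -EFinM; congr (_ + _%:E)%E; ring.
      + exact/measurable_EFinP.
      + by move=> w _; rewrite lee_fin.
    - by move=> w _; rewrite lee_fin sqr_ge0.
    - exact/measurable_EFinP.
    - by move=> w _; rewrite -EFinM lee_fin mulr_ge0.
    - by apply: measurable_funeM; exact/measurable_EFinP.
  rewrite -(@leeD2rE _ (2 * (n%:R * m) ^+ 2)%:E)// -E.
  apply: le_trans (leeD2r _ ES2) _.
  by rewrite -!EFinD lee_fin; apply: eq_ler; ring.
(* [W] is at least 1 on the event: either some term reaches [n], or the
   truncated sum exceeds its mean by [n * a]. *)
pose W w := \sum_(i < n) u (xi i w) ^+ 2 / n%:R ^+ 2 + V w / (n%:R * a) ^+ 2.
set B := [set w | _].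
have mB : measurable B.
  rewrite -[B]setTI; apply: measurable_lte => //.
  by apply: emeasurable_sum => i; exact: measurableT_comp.
rewrite -[X in (P X <= _)%E]setIT -integral_indic//.
have V0 w : 0 <= V w / (n%:R * a) ^+ 2 by rewrite divr_ge0 ?sqr_ge0.
have U0 i w : 0 <= u (xi i w) ^+ 2 / n%:R ^+ 2 by rewrite divr_ge0 ?sqr_ge0.
have BW w : \1_B w <= W w.
  rewrite indicE; case: (boolP (w \in B)) => [|_]; last first.
    by rewrite addr_ge0// sumr_ge0.
  rewrite inE /B/= => wB.
  have [[i ni]|nex] := pselect (exists i : 'I_n, (n%:R%:E <= g (xi i w))%E).
    rewrite ler_wpDr// (bigD1 i)//= ler_wpDr ?sumr_ge0//.
    have -> : u (xi i w) = n%:R by rewrite /u min_r.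
    by rewrite divff// expf_neq0// gt_eqF.
  rewrite ler_wpDl ?sumr_ge0// ler_pdivlMr ?exprn_gt0 ?mulr_gt0// mul1r.
  have Sw : 2 * a * n%:R < S w.
    rewrite -lte_fin (lt_le_trans wB)// /S -sumEFin; apply: lee_sum => i _.
    rewrite uE le_min lexx/= leNgt; apply/negP => /ltW ni.
    by apply: nex; exists i.
  rewrite lerXn2r ?nnegrE ?mulr_ge0 ?(ltW a0)//; nra.
apply: (@le_trans _ _ (\int[P]_w (W w)%:E)%E).
  apply: ge0_le_integral => //.
  - by apply/measurable_EFinP; exact: measurable_indic.
  - apply/measurable_EFinP; apply: measurable_funD.
      apply: measurable_sum => i; apply: measurable_funM => //.
      exact: measurable_funX.
    exact: measurable_funM.
  - by move=> w _; rewrite lee_fin.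
under eq_integral => w _ do rewrite /W EFinD -sumEFin.
rewrite ge0_integralD//; last 4 first.
- by move=> w _; apply: sume_ge0 => i _; rewrite lee_fin.
- apply: emeasurable_sum => i; apply/measurable_EFinP; apply: measurable_funM => //.
  exact: measurable_funX.
- by move=> w _; rewrite lee_fin.
- by apply/measurable_EFinP; exact: measurable_funM.
rewrite ge0_integral_sum//; last 2 first.
- move=> i; apply/measurable_EFinP; apply: measurable_funM => //.
  exact: measurable_funX.
- by move=> i w _; rewrite lee_fin.
have scale d1 (T1 : measurableType d1) (mu1 : {measure set T1 -> \bar R})
    (h : T1 -> R) (c : R) : measurable_fun setT h -> (forall t, 0 <= h t) -> 0 <= c ->
    (\int[mu1]_t (h t / c)%:E = (c^-1)%:E * \int[mu1]_t (h t)%:E)%E.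
  move=> mh h0 c0; under eq_integral => t _ do rewrite mulrC EFinM.
  rewrite ge0_integralZl ?lee_fin ?invr_ge0//; first exact/measurable_EFinP.
  by move=> t _; rewrite lee_fin.
rewrite (eq_bigr (fun=> (v / n%:R ^+ 2)%:E)) => [|i _]; last first.
  rewrite (@iid_integral (fun x => (u x ^+ 2 / n%:R ^+ 2)%:E))//.
  - rewrite scale ?sqr_ge0//; first by rewrite uv -EFinM mulrC.
      exact: measurable_funX.
    by move=> x; rewrite sqr_ge0.
  - apply/measurable_EFinP; apply: measurable_funM => //; exact: measurable_funX.
  - by move=> x; rewrite lee_fin divr_ge0 ?sqr_ge0.
rewrite sum_cst.
rewrite scale ?sqr_ge0//; last by move=> w; rewrite sqr_ge0.
rewrite scale ?(ltW nR)//; last 2 first.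
- exact: measurable_funX.
- by move=> x; rewrite sqr_ge0.
rewrite uv -!EFinM.
apply: (@le_trans _ _ ((n%:R * (v / n%:R ^+ 2))%:E +
    (((n%:R * a) ^+ 2)^-1 * (n%:R * v))%:E)%E).
  by rewrite leeD2l// EFinM lee_wpmul2l// lee_fin invr_ge0 sqr_ge0.
rewrite -EFinD lee_fin; apply: eq_ler.
by field; rewrite !gt_eqF.
Qed.

(** One-sided strong law of large numbers, up to the factor 2.  Along dyadic
    times the truncated second moments add up to a multiple of the mean
    ([sum_dyadic_min_sqr]), so no moment beyond the first is needed, and the
    bound depends on [g] only through [a]. *)
Lemma iid_dyadic_series (g : X -> \bar R) (a : R) :
  measurable_fun setT g -> (forall x, 0 <= g x)%E -> 0 < a ->
  (\int[Q]_x g x <= a%:E)%E ->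
  (\sum_(k <oo) P [set w | (2 * a * (2 ^ k)%:R)%:E <
      \sum_(i < (2 ^ k)%N) g (xi i w)] <=
   ((1 + a ^- 2) * (4 * a))%:E)%E.
Proof.
move=> mg g0 a0 ga.
have C0 : 0 <= 1 + a ^- 2 by rewrite addr_ge0// invr_ge0 sqr_ge0.
pose h k x := fine (mine (g x) (2 ^ k)%:R%:E) ^+ 2 / (2 ^ k)%:R : R.
have h0 k x : 0 <= h k x by rewrite divr_ge0 ?sqr_ge0.
have mh k : measurable_fun setT (h k).
  apply: measurable_funM => //; apply: measurable_funX.
  apply: (measurableT_comp (fine_measurable _)) => //.
  by apply: measurable_mine.
apply: lime_le; first exact: is_cvg_nneseries.
apply: nearW => K.
apply: (@le_trans _ _ (\sum_(0 <= k < K) (1 + a ^- 2)%:E * \int[Q]_x (h k x)%:E)%E).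
  by apply: lee_sum => k _; apply: iid_truncation_bound => //; rewrite expn_gt0.
rewrite -ge0_sume_distrr; last first.
  by move=> k _; apply: integral_ge0 => x _; rewrite lee_fin.
rewrite EFinM lee_wpmul2l// -ge0_integral_sum//; last 2 first.
- by move=> k; exact/measurable_EFinP.
- by move=> k x _; rewrite lee_fin.
apply: (@le_trans _ _ (\int[Q]_x (4%:E * g x))%E).
  apply: ge0_le_integral => //.
  - by move=> x _; apply: sume_ge0 => k _; rewrite lee_fin.
  - by apply: emeasurable_sum => k; exact/measurable_EFinP.
  - exact: measurable_funeM.
  - move=> x _; move: (g0 x); rewrite /h; case: (g x) => [r| |]// r0.
      rewrite sumEFin -EFinM lee_fin.
      apply: le_trans (sum_dyadic_min_sqr K _) => //.
      rewrite big_mkord; apply: eq_ler.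
      by apply: eq_bigr => k _; rewrite -EFin_min/= natrX.
    by rewrite mulry gtr0_sg// mul1e leey.
rewrite ge0_integralZl//.
by rewrite EFinM lee_wpmul2l// lee_fin.
Qed.

End iid_dyadic_bound.

(** * Relative entropy and Hellinger affinity *)

Section relative_entropy.
Context d (X : measurableType d) (R : realType).
Variable lambda : {measure set X -> \bar R}.

Let phi (s f : R) : \bar R := (s%:E * lne (s%:E / f%:E))%E.

Let phiE (s f : R) : 0 <= s -> 0 <= f -> phi s f =
  if f == 0 then (if s == 0 then 0%E else +oo%E) else (s * ln (s / f))%:E.
Proof.
rewrite /phi => s0 f0; rewrite inver; case: ifPn => [_|fn0].
  case: ifPn => [/eqP ->|sn0]; first by rewrite mul0e.
  have sp : 0 < s by rewrite lt_neqAle eq_sym sn0.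
  by rewrite gt0_muley ?lte_fin//= gt0_muley// lte_fin.
have [->|sn0] := eqVneq s 0; first by rewrite mul0r mul0e.
have sp : 0 < s by rewrite lt_neqAle eq_sym sn0.
have fp : 0 < f by rewrite lt_neqAle eq_sym fn0.
by rewrite -EFinM lne_EFin ?divr_gt0// EFinM.
Qed.

Lemma measurable_KL_integrand d' (T : measurableType d') (u v : T -> R) :
  measurable_fun setT u -> measurable_fun setT v ->
  (forall t, 0 <= u t) -> (forall t, 0 <= v t) ->
  measurable_fun setT
    (fun t => ((u t)%:E * lne ((u t)%:E / (v t)%:E))%E).
Proof.
move=> mu mv u0 v0.
rewrite (_ : (fun t => _) = (fun t => if v t == 0 then
    (if u t == 0 then 0%E else +oo%E) else (u t * ln (u t / v t))%:E)); last first.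
  by apply/funext => t; rewrite -phiE.
apply: measurable_fun_ifT; first exact: measurable_fun_eqr.
  by apply: measurable_fun_ifT => //; exact: measurable_fun_eqr.
apply/measurable_EFinP/measurable_funM => //.
apply: measurableT_comp => //; apply: measurable_funM => //.
exact: (measurableT_comp (@measurable_invr R)).
Qed.

(** The negative part of the KL integrand is integrable, since it is dominated
    by the second density; hence a finite divergence has a finite positive
    part. *)
Let negpart_phi_le (s f : R) : 0 <= s -> 0 <= f -> (maxe (- phi s f) 0 <= f%:E)%E.
Proof.
move=> s0 f0; rewrite phiE// ge_max lee_fin f0 andbT.
case: ifPn => [/eqP ->|fn0]; first by case: ifP; rewrite ?oppe0 ?leNye.
rewrite -EFinN lee_fin.
have [->|sn0] := eqVneq s 0; first by rewrite mul0r oppr0.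
have sp : 0 < s by rewrite lt_neqAle eq_sym sn0.
have fp : 0 < f by rewrite lt_neqAle eq_sym fn0.
rewrite -mulrN -lnV ?posrE ?divr_gt0// invf_div.
have h := @le_ln1Dx R (f / s - 1).
have : ln (f / s) <= f / s - 1.
  rewrite -{1}(subrK 1 (f / s)) addrC; apply: h.
  by rewrite ltrBrDl subrr divr_gt0.
move=> /(ler_wpM2l s0) /le_trans; apply.
by rewrite mulrBr mulr1 mulrCA divff// mulr1 gerBl.
Qed.

(** [maxr0_le_entropy] multiplied by [s], with all negative terms moved to the
    other side so that it can be integrated without integrability conditions. *)
Let entropy_ge_neg_log (s f eta : R) : 0 <= s -> 0 <= f -> 0 < eta ->
  (s%:E * neg_log (f / s) + (2 + eta^-1)%:E * (maxe (- phi s f) 0 + s%:E) <=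
   (2 + eta^-1)%:E * (maxe (phi s f) 0 + f%:E) + (eta * s)%:E)%E.
Proof.
move=> s0 f0 eta0.
have K0 : 0 < 2 + eta^-1 by rewrite addr_gt0// invr_gt0.
rewrite phiE//.
have [s00|sn0] := eqVneq s 0.
  rewrite s00 mul0r mul0e add0e !mulr0 !adde0.
  have -> : (if f == 0 then 0%E else 0%:E) = 0%E :> \bar R by case: ifP.
  rewrite oppe0 maxxx mule0 add0e -EFinM lee_fin mulr_ge0// ltW//.
have sp : 0 < s by rewrite lt_neqAle eq_sym sn0.
case: ifPn => [_|fn0].
  have -> : (maxe (+oo) 0 = +oo :> \bar R)%E by rewrite max_l// leey.
  by rewrite addye// gt0_muley ?lte_fin// addye// leey.
have fp : 0 < f by rewrite lt_neqAle eq_sym fn0.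
have rp : 0 < f / s by rewrite divr_gt0.
rewrite /neg_log (_ : (f / s <= 0) = false); last by rewrite leNgt rp.
rewrite -EFinN -!EFin_max -!(EFinD, EFinM) lee_fin.
rewrite -lnV ?posrE// invf_div; set y := ln (s / f).
have ey : expR (- y) = f / s.
  by rewrite /y -lnV ?posrE ?divr_gt0// invf_div lnK ?posrE.
have := maxr0_le_entropy y eta0; rewrite ey => H.
have maxE : Num.max (s * y) 0 = Num.max (- (s * y)) 0 + s * y.
  by have [|] := leP (s * y) 0; have [|] := leP (- (s * y)) 0; lra.
rewrite maxE.
have := ler_wpM2l s0 H.
have -> : s * ((2 + eta^-1) * (y - 1 + f / s) + eta) =
   (2 + eta^-1) * (s * y - s + f) + eta * s.
  by field; rewrite sn0 gt_eqF.
move=> H1; lra.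
Qed.

(** Choosing [eta] first and then [delta], the right-hand side is as small as
    desired, whatever the density [f]. *)
Lemma integral_neg_log_le (s f : X -> R) (delta eta : R) :
  is_density lambda s -> is_density lambda f -> 0 < eta ->
  (KL lambda s f < delta%:E)%E ->
  (\int[lambda]_x ((s x)%:E * neg_log (f x / s x)) <=
   ((2 + eta^-1) * delta + eta)%:E)%E.
Proof.
move=> [ms s0 s1] [mf f0 f1] eta0.
rewrite /KL; set h := fun x => ((s x)%:E * lne ((s x)%:E / (f x)%:E))%E.
have mh : measurable_fun setT h by exact: measurable_KL_integrand.
have mhp : measurable_fun setT (h^\+)%E by exact: measurable_funepos.
have mhn : measurable_fun setT (h^\-)%E by exact: measurable_funeneg.
rewrite -[X in (X < _)%E -> _]/(\int[lambda]_x h x)%E integralE.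
set a := (\int[lambda]_x h^\+ x)%E; set b := (\int[lambda]_x h^\- x)%E.
have K0 : 0 < 2 + eta^-1 by rewrite addr_gt0// invr_gt0.
have sE : measurable_fun setT (EFin \o s) by exact/measurable_EFinP.
have fE : measurable_fun setT (EFin \o f) by exact/measurable_EFinP.
have s0E x : (0 <= (s x)%:E)%E by rewrite lee_fin.
have f0E x : (0 <= (f x)%:E)%E by rewrite lee_fin.
have a0 : (0 <= a)%E by apply: integral_ge0.
have b0 : (0 <= b)%E by apply: integral_ge0.
have b1 : (b <= 1)%E.
  rewrite -f1; apply: ge0_le_integral => // x _.
  by rewrite funenegE; apply: negpart_phi_le.
have bfin : b \is a fin_num by rewrite ge0_fin_numE// (le_lt_trans b1)// ltry.
rewrite lteBlDr// => ab.
have afin : a \is a fin_num.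
  by rewrite ge0_fin_numE// (lt_trans ab)// -(fineK bfin) -EFinD ltry.
set A := (\int[lambda]_x _)%E.
have mnl : measurable_fun setT (fun x => (s x)%:E * neg_log (f x / s x))%E.
  apply: emeasurable_funM => //; apply: measurable_neg_log.
  by apply: measurable_funM => //; exact: (measurableT_comp (@measurable_invr R)).
have nl0 x : (0 <= (s x)%:E * neg_log (f x / s x))%E.
  by rewrite mule_ge0// neg_log_ge0.
have key : (A + (2 + eta^-1)%:E * (b + 1) <= (2 + eta^-1)%:E * (a + 1) + eta%:E)%E.
  have intK (u v : X -> \bar R) : measurable_fun setT u -> measurable_fun setT v ->
     (forall x, 0 <= u x)%E -> (forall x, 0 <= v x)%E ->
     (\int[lambda]_x ((2 + eta^-1)%:E * (u x + v x)) =
      (2 + eta^-1)%:E * (\int[lambda]_x u x + \int[lambda]_x v x))%E.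
    move=> mu mv u0 v0; rewrite ge0_integralZl// ?lee_fin ?ltW//.
    - by rewrite ge0_integralD.
    - exact: emeasurable_funD.
    - by move=> x _; rewrite adde_ge0.
  rewrite -[in X in (X <= _)%E]s1 -[in X in (_ <= X)%E]f1.
  rewrite -!intK//.
  have -> : (eta%:E = \int[lambda]_x (eta%:E * (s x)%:E))%E.
    by rewrite ge0_integralZl ?lee_fin ?ltW// s1 mule1.
  have mL (u v : X -> \bar R) : measurable_fun setT u -> measurable_fun setT v ->
      measurable_fun setT (fun x => (2 + eta^-1)%:E * (u x + v x))%E.
    by move=> mu mv; apply: measurable_funeM; exact: emeasurable_funD.
  have L0 (u v : X -> \bar R) x : (0 <= u x)%E -> (0 <= v x)%E ->
      (0 <= (2 + eta^-1)%:E * (u x + v x))%E.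
    by move=> u0 v0; rewrite mule_ge0 ?adde_ge0// lee_fin ltW.
  rewrite -ge0_integralD//; last 2 first.
  - by move=> x _; apply: (L0 (h^\-)%E (EFin \o s)) => //=.
  - exact: (mL (h^\-)%E (EFin \o s)).
  rewrite -ge0_integralD//; last 4 first.
  - by move=> x _; apply: (L0 (h^\+)%E (EFin \o f)) => //=.
  - exact: (mL (h^\+)%E (EFin \o f)).
  - by move=> x _; rewrite mule_ge0// lee_fin ltW.
  - exact: measurable_funeM.
  apply: ge0_le_integral => //.
  - by move=> x _; apply: adde_ge0 => //; apply: (L0 (h^\-)%E (EFin \o s)) => //=.
  - by apply: emeasurable_funD => //; exact: (mL (h^\-)%E (EFin \o s)).
  - by apply: emeasurable_funD; [exact: (mL (h^\+)%E (EFin \o f))|exact: measurable_funeM].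
  - by move=> x _; rewrite funenegE funeposE -[(eta%:E * _)%E]EFinM; exact: entropy_ge_neg_log.
move: key ab; rewrite -(fineK afin) -(fineK bfin) -!(EFinD, EFinM).
rewrite -leeBrDr// -EFinB lte_fin => /le_trans h1 h2; apply: h1.
rewrite lee_fin; nra.
Qed.

(** Where [s] vanishes the convention [f x / 0 = 0] does no harm, as the weight
    [s x] is 0 there: the integral is the affinity of [f] and [s], that is
    1 minus half of the squared Hellinger distance. *)
Lemma integral_affinity (s f : X -> R) (eps : R) : 0 <= eps ->
  is_density lambda s -> is_density lambda f ->
  eps < hellinger lambda f s ->
  exists2 m : R, 0 <= m <= expR (- (eps ^+ 2 / 2)) &
    (\int[lambda]_x ((s x)%:E * (Num.sqrt (f x / s x))%:E) = m%:E)%E.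
Proof.
move=> eps0 [ms s0 s1] [mf f0 f1]; rewrite /hellinger /Rintegral => epsH.
have mq (u : X -> R) : measurable_fun setT u -> measurable_fun setT (fun x => Num.sqrt (u x)).
  exact: (measurableT_comp (@measurable_sqrt R)).
pose q x := Num.sqrt (f x) * Num.sqrt (s x).
have mqq : measurable_fun setT q by apply: measurable_funM; exact: mq.
have q0 x : 0 <= q x by rewrite mulr_ge0 ?sqrtr_ge0.
have E x : ((s x)%:E * (Num.sqrt (f x / s x))%:E = (q x)%:E)%E.
  rewrite -EFinM /q; congr EFin.
  have [->|sn0] := eqVneq (s x) 0; first by rewrite sqrtr0 mul0r mulr0.
  rewrite sqrtrM// sqrtrV// mulrCA -{1}(sqr_sqrtr (s0 x)) expr2 mulfK//.
  by rewrite sqrtr_eq0 -ltNge lt_neqAle eq_sym sn0 s0.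
under eq_integral => x _ do rewrite E.
set H := (\int[lambda]_x _)%E in epsH *.
set A := (\int[lambda]_x _)%E.
have H0 : (0 <= H)%E by apply: integral_ge0 => x _; rewrite lee_fin sqr_ge0.
have A0 : (0 <= A)%E by apply: integral_ge0 => x _; rewrite lee_fin.
have HA : (H + 2%:E * A = 2%:E)%E.
  transitivity (\int[lambda]_x ((f x)%:E + (s x)%:E))%E; last first.
    by rewrite ge0_integralD ?f1 ?s1//; (try by move=> x _; rewrite lee_fin);
      exact/measurable_EFinP.
  rewrite -ge0_integralZl ?lee_fin//; last 2 first.
  - exact/measurable_EFinP.
  - by move=> x _; rewrite lee_fin.
  rewrite -ge0_integralD//; last 4 first.
  - by move=> x _; rewrite lee_fin sqr_ge0.
  - apply/measurable_EFinP/measurable_funX.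
    by apply: measurable_funB; exact: mq.
  - by move=> x _; rewrite mule_ge0 ?lee_fin.
  - by apply: measurable_funeM; exact/measurable_EFinP.
  apply: eq_integral => x _; rewrite -EFinM -!EFinD; congr EFin.
  rewrite -{2}(sqr_sqrtr (s0 x)) -{2}(sqr_sqrtr (f0 x)) /q; ring.
have Hfin : H \is a fin_num.
  rewrite ge0_fin_numE// (@le_lt_trans _ _ 2%:E) ?ltry//.
  by rewrite -HA leeDl// mule_ge0 ?lee_fin.
have Afin : A \is a fin_num.
  rewrite ge0_fin_numE// (@le_lt_trans _ _ 2%:E) ?ltry//.
  rewrite -HA; apply: (@le_trans _ _ (2%:E * A)%E); last by rewrite leeDr.
  by rewrite lee_pemull// lee_fin ler1n.
exists (fine A); last by rewrite fineK.
rewrite fine_ge0//=.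
have : fine H + 2 * fine A = 2.
  by move: HA; rewrite -(fineK Hfin) -(fineK Afin) -EFinM -EFinD => -[].
have : eps ^+ 2 < fine H.
  rewrite -(sqr_sqrtr (fine_ge0 H0)).
  by rewrite ltrXn2r ?nnegrE ?sqrtr_ge0//.
have := expR_ge1Dx (- (eps ^+ 2 / 2)); lra.
Qed.

End relative_entropy.

(** * Evidence and posterior *)

Section posterior_asymptotics.
Context (R : realType) dX (X : measurableType dX).
Variable lambda : {sigma_finite_measure set X -> \bar R}.
Context dF (F : measurableType dF).
Variable p : F -> X -> R.
Hypothesis p_density : forall f, is_density lambda (p f).
Hypothesis p_joint : jointly_measurable p.
Variables (Pi : probability F R) (fstar : F) (Fstar : probability X R).
Hypothesis Fstar_density : has_density lambda Fstar (p fstar).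
Context dO (Omega : measurableType dO).
Variables (P : probability Omega R) (xi : nat -> {RV P >-> X}).
Hypothesis xi_iid : iid Fstar xi.

Local Notation ratio f x := (p f x / p fstar x).
Local Notation lik n w f := (likelihood_ratio p fstar (fun i => xi i w) n f).

Let p_ge0 f x : 0 <= p f x.
Proof. by case: (p_density f). Qed.

Let measurable_p f : measurable_fun setT (p f).
Proof. by case: (p_density f). Qed.

Let ratio_ge0 f x : 0 <= ratio f x.
Proof. exact: divr_ge0. Qed.

Let measurable_div d (T : measurableType d) (u v : T -> R) : measurable_fun setT u ->
  measurable_fun setT v -> measurable_fun setT (fun t => u t / v t).
Proof.
move=> mu mv; apply: measurable_funM => //.
exact: (measurableT_comp (@measurable_invr R)).
Qed.

Let measurable_sqrt_comp d (T : measurableType d) (u : T -> R) : measurable_fun setT u ->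
  measurable_fun setT (fun t => Num.sqrt (u t)).
Proof. exact: (measurableT_comp (@measurable_sqrt R)). Qed.

Let measurable_ratio f : measurable_fun setT (fun x => ratio f x).
Proof. exact: measurable_div. Qed.

Let measurable_ratio_joint i :
  measurable_fun setT (fun wf : Omega * F => ratio wf.2 (xi i wf.1)).
Proof.
have m1 : measurable_fun setT (fun wf : Omega * F => xi i wf.1).
  by apply: (measurableT_comp (f := xi i)).
apply: measurable_div; last exact: measurableT_comp (measurable_p fstar) m1.
apply: (measurableT_comp p_joint (f := fun xf : X * F => p xf.2 xf.1)
  (g := fun wf : Omega * F => (xi i wf.1, wf.2))).
by apply: measurable_fun_pair.
Qed.

Let integral_Fstar (h : X -> \bar R) :
  measurable_fun setT h -> (forall x, 0 <= h x)%E ->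
  (\int[Fstar]_x h x = \int[lambda]_x ((p fstar x)%:E * h x))%E.
Proof.
move=> mh h0.
rewrite (@ge0_integral_weighted _ X _ X R lambda Fstar (p fstar) id 1)//.
  by rewrite mul1e.
move=> A mA; rewrite mul1e; apply: etrans (esym (Fstar_density mA)).
rewrite [RHS]integral_mkcond; apply: eq_integral => x _.
by rewrite patchE indicE; case: ifPn => _; rewrite ?mule1 ?mule0.
Qed.

Let lik_ge0 n w f : 0 <= lik n w f.
Proof. by apply: prodr_ge0. Qed.

Let measurable_lik n : measurable_fun setT (fun wf : Omega * F => lik n wf.1 wf.2).
Proof. by apply: measurable_prod => i _; exact: measurable_ratio_joint. Qed.

Let measurable_section d (T : measurableType d) (h : Omega * F -> T) w :
  measurable_fun setT h -> measurable_fun setT (fun f => h (w, f)).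
Proof. by move=> mh; exact: (measurableT_comp mh (pair1_measurable w)). Qed.

Let measurable_hellinger_gt (eps : R) :
  measurable [set f | eps < hellinger lambda (p f) (p fstar)].
Proof.
have mH : measurable_fun setT (fun f => hellinger lambda (p f) (p fstar)).
  apply: measurable_sqrt_comp; apply: (measurableT_comp (fine_measurable _)) => //.
  pose h (xf : X * F) : \bar R :=
    ((Num.sqrt (p xf.2 xf.1) - Num.sqrt (p fstar xf.1)) ^+ 2)%:E.
  apply: (@measurable_fun_fubini_tonelli_G _ _ _ _ R lambda h).
    apply/measurable_EFinP/measurable_funX/measurable_funB; apply: measurable_sqrt_comp => //.
    exact: measurableT_comp (measurable_p fstar) _.
  by move=> xf; rewrite lee_fin sqr_ge0.
exact: measurable_set_ltr.
Qed.

Let measurable_KL_lt (delta : R) :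
  measurable [set f | (KL lambda (p fstar) (p f) < delta%:E)%E].
Proof.
rewrite -[X in measurable X]setTI; apply: measurable_lte => //.
pose h (xf : X * F) : \bar R :=
  ((p fstar xf.1)%:E * lne ((p fstar xf.1)%:E / (p xf.2 xf.1)%:E))%E.
have mh : measurable_fun setT h.
  apply: measurable_KL_integrand => //.
  exact: measurableT_comp (measurable_p fstar) _.
rewrite (_ : (fun f => _) = (fun f =>
    \int[lambda]_x (h^\+)%E (x, f) - \int[lambda]_x (h^\-)%E (x, f))%E); last first.
  apply/funext => f; rewrite /KL integralE; congr (_ - _)%E;
  by apply: eq_integral => x _; rewrite ?funeposE ?funenegE.
apply: emeasurable_funB.
- apply: (@measurable_fun_fubini_tonelli_G _ _ _ _ R lambda (h^\+)%E) => //.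
  exact: measurable_funepos.
- apply: (@measurable_fun_fubini_tonelli_G _ _ _ _ R lambda (h^\-)%E) => //.
  exact: measurable_funeneg.
Qed.

Let measurable_section_integral (h : Omega * F -> R) (M : set (Omega * F)) :
  measurable_fun setT h -> (forall wf, 0 <= h wf) -> measurable M ->
  measurable_fun setT (fun w => \int[Pi]_(f in [set f | M (w, f)]) h (w, f)).
Proof.
move=> mh h0 mM.
apply: (measurableT_comp (fine_measurable _)) => //.
pose hM wf : \bar R := (h wf * \1_M wf)%:E.
rewrite (_ : (fun w => _) = fubini_F Pi hM).
  apply: measurable_fun_fubini_tonelli_F.
    by apply/measurable_EFinP/measurable_funM => //; exact: measurable_indic.
  by move=> wf; rewrite lee_fin mulr_ge0.
apply/funext => w; rewrite integral_mkcond; apply: eq_integral => f _.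
by rewrite /hM patchE indicE; case: ifPn; rewrite !(inE, notin_setE)/= => H;
  [rewrite mem_set// mulr1|rewrite memNset// mulr0].
Qed.

Let measurable_posterior (n : nat) (M : set (Omega * F)) : measurable M ->
  measurable_fun setT
    (fun w => posterior Pi p fstar (fun i => xi i w) n [set f | M (w, f)]).
Proof.
move=> mM; apply: measurable_div.
  exact: (measurable_section_integral (measurable_lik n)).
exact: (measurable_section_integral (M := setT) (measurable_lik n)).
Qed.

Let root n w f : R := \prod_(i < n) Num.sqrt (ratio f (xi i w)).

Let root_ge0 n w f : 0 <= root n w f.
Proof. by apply: prodr_ge0 => i _; exact: sqrtr_ge0. Qed.

Let root_sqr n w f : root n w f ^+ 2 = lik n w f.
Proof. by rewrite -prodrXl; apply: eq_bigr => i _; rewrite sqr_sqrtr. Qed.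

Let measurable_root n : measurable_fun setT (fun wf : Omega * F => root n wf.1 wf.2).
Proof. by apply: measurable_prod => i _; apply: measurable_sqrt_comp; exact: measurable_ratio_joint. Qed.

Let integral_root (eps : R) n : 0 < eps ->
  (\int[P]_w \int[Pi]_(f in [set f | (eps < hellinger lambda (p f) (p fstar))%R])
     (root n w f)%:E <= (expR (- (eps ^+ 2 / 2) * n%:R))%:E)%E.
Proof.
move=> eps0; set A := [set f | _].
have mA : measurable A by exact: measurable_hellinger_gt.
pose h (wf : Omega * F) : \bar R := (root n wf.1 wf.2 * \1_A wf.2)%:E.
have mh : measurable_fun setT h.
  apply/measurable_EFinP/measurable_funM => //.
  by apply: measurableT_comp => //; exact: measurable_indic.
have h0 wf : (0 <= h wf)%E by rewrite lee_fin mulr_ge0.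
have -> : (\int[P]_w \int[Pi]_(f in A) (root n w f)%:E =
    \int[P]_w fubini_F Pi h w)%E.
  apply: eq_integral => w _; rewrite integral_mkcond; apply: eq_integral => f _.
  by rewrite /h patchE indicE /=; case: ifPn => _; rewrite ?mulr1 ?mulr0.
rewrite (@fubini_tonelli _ _ _ _ R P Pi h mh h0).
set c := expR _.
apply: (@le_trans _ _ (\int[Pi]_f cst c%:E f)%E); last first.
  by rewrite integral_cst_probability.
apply: ge0_le_integral => //.
- by move=> f _; apply: integral_ge0.
- exact: measurable_fun_fubini_tonelli_G.
- move=> f _; rewrite /fubini_G /h/= indicE.
  case: (boolP (f \in A)) => fA; last first.
    under eq_integral do rewrite mulr0.
    by rewrite integral0 lee_fin expR_ge0.
  under eq_integral do rewrite mulr1.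
  have [m /andP[m0 mle] Em] := integral_affinity (ltW eps0) (p_density fstar)
    (p_density f) (set_mem fA).
  rewrite (iid_prod xi_iid n (g := fun _ x => Num.sqrt (ratio f x)) (m := fun=> m)).
  + rewrite lee_fin prodr_const card_ord.
    apply: (@le_trans _ _ (expR (- (eps ^+ 2 / 2)) ^+ n)).
      by rewrite lerXn2r ?nnegrE ?expR_ge0.
    by rewrite -expRM_natl mulrC.
  + by move=> _; apply: measurable_sqrt_comp.
  + by move=> _ x; exact: sqrtr_ge0.
  + move=> _; rewrite (integral_Fstar (h := fun x => (Num.sqrt (ratio f x))%:E))//.
    by apply/measurable_EFinP; exact: measurable_sqrt_comp.
Qed.

(** Expectations decay geometrically at the rate [c - eps ^ 2 / 2 < 0]. *)
Let root_vanish (eps c : R) : 0 < eps -> c < eps ^+ 2 / 2 ->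
  {ae P, forall w, ((expR (c * n%:R))%:E *
    \int[Pi]_(f in [set f | (eps < hellinger lambda (p f) (p fstar))%R])
     (root n w f)%:E)%E @[n --> \oo] --> 0%E}.
Proof.
move=> eps0 ceps; set A := [set f | _].
have mA : measurable A by exact: measurable_hellinger_gt.
have mI n : measurable_fun setT (fun w => \int[Pi]_(f in A) (root n w f)%:E)%E.
  pose h (wf : Omega * F) : \bar R := (root n wf.1 wf.2 * \1_A wf.2)%:E.
  rewrite (_ : (fun w => _) = fubini_F Pi h).
    apply: measurable_fun_fubini_tonelli_F.
      apply/measurable_EFinP/measurable_funM => //.
      by apply: measurableT_comp => //; exact: measurable_indic.
    by move=> wf; rewrite lee_fin mulr_ge0.
  apply/funext => w; rewrite integral_mkcond; apply: eq_integral => f _.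
  by rewrite /h patchE indicE /=; case: ifPn => _; rewrite ?mulr1 ?mulr0.
have I0 n w : (0 <= \int[Pi]_(f in A) (root n w f)%:E)%E.
  by apply: integral_ge0 => f _; rewrite lee_fin.
apply: ae_cvg0_summable_integral.
- by move=> n; exact: measurable_funeM.
- by move=> n w; rewrite mule_ge0// lee_fin expR_ge0.
pose r := expR (c - eps ^+ 2 / 2).
have r1 : r < 1 by rewrite /r -[ltRHS]expR0 ltr_expR subr_lt0.
have r0 : 0 < r by exact: expR_gt0.
apply: (@le_lt_trans _ _ (\sum_(n <oo) (r ^+ n)%:E)%E).
  apply: lee_nneseries => [n _ _|n _].
    by apply: integral_ge0 => w _; rewrite mule_ge0// lee_fin expR_ge0.
  rewrite ge0_integralZl ?lee_fin ?expR_ge0//.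
  apply: (@le_trans _ _ ((expR (c * n%:R))%:E * (expR (- (eps ^+ 2 / 2) * n%:R))%:E)%E).
    by rewrite lee_wpmul2l ?lee_fin ?expR_ge0//; exact: integral_root.
  by rewrite -EFinM lee_fin -expRD -mulrDl mulrC /r expRM_natl.
have rs : (fun n => \sum_(0 <= k < n) (r ^+ k)%:E)%E @ \oo --> ((1 - r)^-1)%:E.
  rewrite (_ : (fun n => _) = EFin \o series (geometric 1 r)); last first.
    apply/funext => n; rewrite /series/= sumEFin; congr EFin.
    by apply: eq_bigr => k _; rewrite mul1r.
  apply: cvg_EFin; first exact: nearW.
  rewrite -[X in _ --> X]mul1r; apply: cvg_geometric_series.
  by rewrite ger0_norm// ltW.
by rewrite (cvg_lim _ rs)// ltry.
Qed.

(** Only the prior mass of a KL ball is used.  The series of prior masses [u k]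
    of its bad densities at scale [2 ^ k] has finite expectation because
    [iid_dyadic_series] is uniform over the ball. *)
Let evidence_lower_bound (c : R) : KL_support lambda Pi p fstar -> 0 < c ->
  {ae P, forall w, exists2 q : R, 0 < q & \forall n \near \oo,
     ((q * expR (- (c * n%:R)))%:E <= \int[Pi]_f (lik n w f)%:E)%E}.
Proof.
move=> KLs c0.
(* A factor 2 is lost to the deviation of the sum from its mean, another one
   when rounding [n] up to a power of 2. *)
pose a := c / 4; pose eta := a / 2; pose delta := (a / 2) / (2 + eta^-1).
have a0 : 0 < a by rewrite divr_gt0.
have eta0 : 0 < eta by rewrite divr_gt0.
have K0 : 0 < 2 + eta^-1 by rewrite addr_gt0// invr_gt0.
have delta0 : 0 < delta by rewrite !divr_gt0.
pose B := [set f | (KL lambda (p fstar) (p f) < delta%:E)%E].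
have mB : measurable B by exact: measurable_KL_lt.
pose b := fine (Pi B).
have PiB : Pi B = b%:E by rewrite fineK// fin_num_measure.
have b0 : 0 < b by rewrite -lte_fin -PiB; exact: KLs.
pose g f x := neg_log (ratio f x).
have mg f : measurable_fun setT (g f) by exact: measurable_neg_log.
have g0 f x : (0 <= g f x)%E by exact: neg_log_ge0.
have gB f : B f -> (\int[Fstar]_x g f x <= a%:E)%E.
  move=> Bf; rewrite integral_Fstar//.
  apply: le_trans (integral_neg_log_le (p_density fstar) (p_density f) eta0 Bf) _.
  by rewrite lee_fin /delta mulrC divfK ?gt_eqF// -splitr.
pose s n (wf : Omega * F) : \bar R := (\sum_(i < n) g wf.2 (xi i wf.1))%E.
have ms n : measurable_fun setT (s n).
  by apply: emeasurable_sum => i; apply: measurable_neg_log; exact: measurable_ratio_joint.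
pose bad k : set (Omega * F) :=
  [set wf | (2 * a * (2 ^ k)%:R)%:E < s (2 ^ k)%N wf]%E `&` (snd @^-1` B).
have mbad k : measurable (bad k).
  apply: measurableI.
    rewrite -[X in measurable X]setTI; exact: measurable_lte.
  rewrite -[X in measurable X]setTI; exact: measurable_snd.
pose C := (1 + a ^- 2) * (4 * a).
have C0 : 0 <= C by rewrite mulr_ge0 ?addr_ge0 ?invr_ge0 ?sqr_ge0// mulr_ge0// ltW.
have section_series f : (\sum_(k <oo) P (ysection (bad k) f) <= C%:E)%E.
  have [Bf|nBf] := pselect (B f).
    apply: le_trans (iid_dyadic_series xi_iid (mg f) (g0 f) a0 (gB f Bf)).
    apply: lee_nneseries => // k _.
    rewrite (_ : ysection _ _ = [set w | (2 * a * (2 ^ k)%:R)%:E <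
      \sum_(i < (2 ^ k)%N) g f (xi i w)]%E)//.
    by apply/seteqP; split => w; rewrite /ysection/= inE => // -[].
  rewrite eseries0 ?lee_fin// => k _ _.
  rewrite (_ : ysection _ _ = set0)// -subset0 => w.
  by rewrite /ysection/= inE => -[].
pose u k w := Pi (xsection (bad k) w).
have mu_ k : measurable_fun setT (u k) by exact: measurable_fun_xsection.
have Eu k : (\int[P]_w u k w = \int[Pi]_f P (ysection (bad k) f))%E.
  have := @indic_fubini_tonelli _ _ _ _ R P Pi (bad k) (mbad k).
  by rewrite indic_fubini_tonelli_FE// indic_fubini_tonelli_GE.
have usum : (\sum_(k <oo) \int[P]_w u k w < +oo)%E.
  apply: (@le_lt_trans _ _ C%:E); last exact: ltry.
  rewrite (eq_eseriesr (g := fun k => \int[Pi]_f P (ysection (bad k) f))%E)//.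
  have mys k : measurable_fun setT (fun f => P (ysection (bad k) f)).
    exact: measurable_fun_ysection.
  rewrite -integral_nneseries//.
  apply: (@le_trans _ _ (\int[Pi]_f cst C%:E f)%E); last first.
    by rewrite integral_cst_probability.
  apply: ge0_le_integral => //.
  - by move=> f _; apply: nneseries_ge0.
  - exact: ge0_emeasurable_sum.
have := ae_cvg0_summable_integral mu_ (fun k w => measure_ge0 _ _) usum.
apply: filterS => w uw.
have b20 : 0 < b / 2 by rewrite divr_gt0.
exists (b / 2) => //.
have [N _ HN] : \forall k \near \oo, (u k w < (b / 2)%:E)%E.
  apply: (uw [set y | (y < (b / 2)%:E)%E]).
  by apply: open_ereal_lt'; rewrite lte_fin.
exists (2 ^ N)%N => // n /= Nn.
have n0 : (0 < n)%N by rewrite (leq_trans _ Nn)// expn_gt0.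
have /andP[kn nk] := trunc_log_bounds (isT : (1 < 2)%N) n0.
set k := trunc_log 2 n in kn nk.
have Nk : (N <= k.+1)%N.
  by rewrite ltnW// -(ltn_exp2l _ _ (isT : (1 < 2)%N)) (leq_ltn_trans Nn).
pose G := B `\` xsection (bad k.+1) w.
have mG : measurable G by apply: measurableD => //; exact: measurable_xsection.
have PiG : ((b / 2)%:E <= Pi G)%E.
  have E : (b%:E = Pi G + Pi (B `&` xsection (bad k.+1) w))%E.
    rewrite -PiB; apply: measureDI => //; exact: measurable_xsection.
  have : (Pi (B `&` xsection (bad k.+1) w) <= (b / 2)%:E)%E.
    apply: le_trans (ltW (HN _ Nk)); apply: le_measure; rewrite ?inE//.
    - by apply: measurableI => //; exact: measurable_xsection.
    - exact: measurable_xsection.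
  rewrite -(leeD2lE (x := Pi G)) ?fin_num_measure// -E => h.
  by rewrite -(leeD2rE (x := (b / 2)%:E))// -EFinD -splitr.
have likG f : G f -> expR (- (c * n%:R)) <= lik n w f.
  move=> [Bf nbad]; apply: (expRN_le_prod (r := fun i => ratio f (xi i w))) => //.
  have : (s (2 ^ k.+1)%N (w, f) <= (2 * a * (2 ^ k.+1)%:R)%:E)%E.
    rewrite leNgt; apply/negP => sf; apply: nbad.
    by rewrite /xsection/= inE.
  move=> sle; apply: le_trans (le_trans sle _).
    rewrite /s/= -(big_mkord xpredT (fun i => g f (xi i w))).
    rewrite -(big_mkord xpredT (fun i => neg_log (ratio f (xi i w)))).
    by apply: lee_sum_nneg_natr => //; exact: ltnW.
  rewrite lee_fin expnS natrM.
  have : (2 ^ k)%:R <= n%:R :> R by rewrite ler_nat.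
  rewrite /a; nra.
apply: (@le_trans _ _ (\int[Pi]_f ((expR (- (c * n%:R)))%:E * (\1_G f)%:E))%E).
  rewrite ge0_integralZl ?lee_fin ?expR_ge0//; last first.
    by apply/measurable_EFinP; exact: measurable_indic.
  rewrite integral_indic// setIT mulrC EFinM lee_wpmul2l// lee_fin expR_ge0.
apply: ge0_le_integral => //.
- by apply: measurable_funeM; apply/measurable_EFinP; exact: measurable_indic.
- by apply/measurable_EFinP; exact: (measurable_section w (measurable_lik n)).
- move=> f _; rewrite -EFinM lee_fin indicE; case: (boolP (f \in G)) => fG.
    by rewrite mulr1 likG//; exact: set_mem.
  by rewrite mulr0.
Qed.


Let post_ge0 n w S : 0 <= posterior Pi p fstar (fun i => xi i w) n S.
Proof. by rewrite divr_ge0// Rintegral_ge0. Qed.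

Section splitting.
Variables (eps alpha beta : R).

Local Notation far := [set f | eps < hellinger lambda (p f) (p fstar)].
Local Notation mid n w :=
  [set f | expR (alpha * n%:R) <= lik n w f <= expR (beta * n%:R)].
Local Notation high n w := [set f | expR (beta * n%:R) < lik n w f].
Local Notation post n w S := (posterior Pi p fstar (fun i => xi i w) n S).

Let measurable_mid n : measurable [set wf : Omega * F |
  expR (alpha * n%:R) <= lik n wf.1 wf.2 <= expR (beta * n%:R)].
Proof.
rewrite (_ : [set wf | _] = [set wf | expR (alpha * n%:R) <= lik n wf.1 wf.2] `&`
    [set wf | lik n wf.1 wf.2 <= expR (beta * n%:R)]).
  by apply: measurableI; apply: measurable_set_ler => //; exact: measurable_lik.
by apply/seteqP; split => wf /= => [/andP|/andP].
Qed.

(** The last term accounts for the far densities whose likelihood ratio is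
    below [expR (alpha * n)], where it is at most [expR (alpha / 2 * n)] times
    its square root. *)
Let posterior_far_le n w :
  (\int[Pi]_(f in far) (root n w f)%:E)%E \is a fin_num ->
  post n w far <= post n w (mid n w) + post n w (high n w) +
    expR (alpha / 2 * n%:R) * fine (\int[Pi]_(f in far) (root n w f)%:E)%E /
    fine (\int[Pi]_f (lik n w f)%:E)%E.
Proof.
rewrite /posterior /Rintegral.
set N := (\int[Pi]_(f in far) (root n w f)%:E)%E => Nfin.
set D := (\int[Pi]_f (lik n w f)%:E)%E.
have lE : measurable_fun setT (fun f => (lik n w f)%:E).
  by apply/measurable_EFinP; exact: (measurable_section w (measurable_lik n)).
have l0 f : (0 <= (lik n w f)%:E)%E by rewrite lee_fin.
have D0 : (0 <= D)%E by apply: integral_ge0 => f _; rewrite lee_fin.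
(* Infinite evidence makes all the posterior probabilities 0. *)
have [Dfin|] := boolP (D \is a fin_num); last first.
  rewrite ge0_fin_numE// -leNgt leye_eq => /eqP ->.
  by rewrite /= invr0 !mulr0 !addr0.
have Dlt : (D < +oo)%E by rewrite -ge0_fin_numE.
rewrite -!mulrDl ler_wpM2r ?invr_ge0 ?fine_ge0//.
have sub S : measurable S -> (\int[Pi]_(f in S) (lik n w f)%:E)%E \is a fin_num.
  move=> mS; rewrite ge0_fin_numE ?integral_ge0// (le_lt_trans _ Dlt)//.
  by apply: ge0_subset_integral.
have mM : measurable (mid n w).
  rewrite (_ : mid n w = xsection [set wf | expR (alpha * n%:R) <= lik n wf.1 wf.2 <=
    expR (beta * n%:R)] w); first exact: measurable_xsection.
  by apply/seteqP; split => f; rewrite /xsection/= inE.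
have mH : measurable (high n w).
  by apply: measurable_set_ltr => //; exact: (measurable_section w (measurable_lik n)).
have mA : measurable far by exact: measurable_hellinger_gt.
pose e := expR (alpha / 2 * n%:R).
have key : (\int[Pi]_(f in far) (lik n w f)%:E <=
    \int[Pi]_(f in mid n w) (lik n w f)%:E +
    \int[Pi]_(f in high n w) (lik n w f)%:E + e%:E * N)%E.
  have mr S (h : F -> R) : measurable S -> measurable_fun setT h ->
      measurable_fun setT ((EFin \o h) \_ S).
    move=> mS mh; apply: (iffLR (measurable_restrictT _ mS)).
    by apply: measurable_funTS; exact/measurable_EFinP.
  have r0 S (h : F -> R) f : (forall f, 0 <= h f) -> (0 <= ((EFin \o h) \_ S) f)%E.
    by move=> h0; rewrite patchE; case: ifP => // _; rewrite lee_fin.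
  have ml : measurable_fun setT (fun f => lik n w f) by exact: (measurable_section w (measurable_lik n)).
  have mrt : measurable_fun setT (fun f => root n w f) by exact: (measurable_section w (measurable_root n)).
  rewrite /N !(integral_mkcond far) (integral_mkcond (mid n w)).
  rewrite (integral_mkcond (high n w)).
  rewrite -ge0_integralZl ?lee_fin ?expR_ge0//; last 2 first.
  - exact: mr.
  - by move=> f _; exact: r0.
  rewrite -ge0_integralD//; try by [exact: mr|move=> f _; exact: r0].
  rewrite -ge0_integralD//; last 4 first.
  - by move=> f _; rewrite adde_ge0// r0.
  - by apply: emeasurable_funD; exact: mr.
  - by move=> f _; rewrite mule_ge0 ?r0// lee_fin expR_ge0.
  - by apply: measurable_funeM; exact: mr.
  apply: ge0_le_integral => //.
  - by move=> f _; exact: r0.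
  - exact: mr.
  - apply: emeasurable_funD; first by apply: emeasurable_funD; exact: mr.
    by apply: measurable_funeM; exact: mr.
  - move=> f _; rewrite !patchE.
    case: ifPn => [fA|_]; last first.
      rewrite mule0 adde0 adde_ge0//.
      + by case: ifP.
      + by case: ifP.
    have [lo|hi] := ltP (lik n w f) (expR (alpha * n%:R)).
      apply: (@le_trans _ _ (e%:E * (root n w f)%:E)%E).
        rewrite -EFinM lee_fin -root_sqr expr2 ler_wpM2r//.
        rewrite -(@ler_pXn2r _ 2) ?nnegrE ?expR_ge0//.
        rewrite root_sqr /e -expRM_natl (le_trans (ltW lo))// ler_expR.
        by rewrite mulrA mulrCA divff// mulr1.
      rewrite leeDr// adde_ge0//.
      + by case: ifP.
      + by case: ifP.
    have e0 : (0 <= e%:E * (root n w f)%:E)%E by rewrite mule_ge0// lee_fin ?expR_ge0.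
    have [lo'|hi'] := leP (lik n w f) (expR (beta * n%:R)).
      rewrite (_ : f \in mid n w) ?inE/= ?hi ?lo'//.
      rewrite -addeA leeDl// adde_ge0//; case: ifP => //.
    rewrite (_ : f \in high n w) ?inE//.
    rewrite addeAC leeDr// adde_ge0//; case: ifP => //.
rewrite -[X in _ <= X]/(fine (EFin _)) -lee_fin.
rewrite !EFinD EFinM !fineK ?sub//.
Qed.

(** Inconsistency fails with every threshold [1 / k.+1], hence almost surely the
    posterior mass is eventually below each of these countably many thresholds. *)
Let post_mid_vanish : ~ inconsistent xi Pi p fstar alpha beta ->
  {ae P, forall w, post n w (mid n w) @[n --> \oo] --> (0 : R)}.
Proof.
move=> nincons.
have H k : {ae P, forall w, \forall n \near \oo, post n w (mid n w) <= k.+1%:R^-1}.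
  pose E n := [set w | k.+1%:R^-1 < post n w (mid n w)].
  have mE n : measurable (E n).
    apply: measurable_set_ltr => //.
    exact: (measurable_posterior n (measurable_mid n)).
  have mlim : measurable (lim_sup_set E).
    by apply: bigcap_measurable => // n _; apply: bigcup_measurable => m _.
  exists (lim_sup_set E); split => //.
    apply/eqP; rewrite eq_le measure_ge0 andbT leNgt; apply/negP => PE.
    by apply: nincons; exists (k.+1%:R^-1); rewrite ?invr_gt0.
  move=> w /= Hw n _; apply: contrapT => nE; apply: Hw.
  exists n => // m /= nm; rewrite leNgt; apply/negP => Em.
  by apply: nE; exists m.
move/ae_foralln: H; apply: filterS => w Hw.
apply/cvgrPdist_lt => e e0.
have [k _ /(_ k (leqnn k)) /= ke] := near_infty_natSinv_lt (PosNum e0).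
have := Hw k; apply: filterS => n hn.
by rewrite sub0r normrN ger0_norm// (le_lt_trans hn).
Qed.

Lemma posterior_far_vanishes : 0 < eps -> 0 < alpha -> alpha <= eps ^+ 2 / 2 ->
  KL_support lambda Pi p fstar ->
  beta_bounded xi Pi p fstar beta -> ~ inconsistent xi Pi p fstar alpha beta ->
  {ae P, forall w, post n w far @[n --> \oo] --> (0 : R)}.
Proof.
move=> eps0 alpha0 alphaeps KLs bounded nincons.
(* The exponents [alpha / 2 <= eps ^ 2 / 4] of the numerator and [c] of the
   evidence add up to at most [c1], which is below [eps ^ 2 / 2]. *)
pose c := eps ^+ 2 / 8; pose c1 := 3 * c.
have c0 : 0 < c by rewrite divr_gt0 ?exprn_gt0.
have c1lt : c1 < eps ^+ 2 / 2.
  by rewrite /c1 /c; have := exprn_gt0 2 eps0; lra.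
have midhigh : {ae P, forall w, post n w (mid n w) @[n --> \oo] --> (0 : R) /\
    post n w (high n w) @[n --> \oo] --> (0 : R)}.
  by move: (post_mid_vanish nincons) bounded; apply: filterS2 => w.
move: (evidence_lower_bound KLs c0) (root_vanish eps0 c1lt) midhigh.
apply: filterS3 => w [q q0 Hev] /fine_cvgP[Hfin Hroot] [Hmid Hhigh].
pose N n := (\int[Pi]_(f in far) (root n w f)%:E)%E.
have N0 n : (0 <= N n)%E by apply: integral_ge0 => f _; rewrite lee_fin.
pose v n := fine ((expR (c1 * n%:R))%:E * N n)%E.
have Hv : post n w (mid n w) + post n w (high n w) + v n / q @[n --> \oo] --> (0 : R).
  rewrite -[X in _ --> X](addr0 (0 : R)); apply: cvgD.
    by rewrite -[X in _ --> X](addr0 (0 : R)); apply: cvgD.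
  by rewrite -[X in _ --> X](mul0r q^-1); apply: cvgM; last exact: cvg_cst.
apply: (squeeze_cvgr _ (@cvg_cst _ (0 : R) _ _ _) Hv).
near=> n.
have vfin : ((expR (c1 * n%:R))%:E * N n)%E \is a fin_num by near: n.
have evn : ((q * expR (- (c * n%:R)))%:E <= \int[Pi]_f (lik n w f)%:E)%E by near: n.
have Nfin : N n \is a fin_num.
  rewrite ge0_fin_numE// ltNge leye_eq; apply/negP => /eqP NE; move: vfin.
  by rewrite NE gt0_muley// lte_fin expR_gt0.
rewrite post_ge0/=; apply: le_trans (posterior_far_le Nfin) _.
rewrite lerD2l -/(N n) /v fineM//= .
set D := (\int[Pi]_f _)%E in evn *.
have [Dfin|Dinf] := boolP (D \is a fin_num); last first.
  have -> : fine D = 0.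
    by move: Dinf; rewrite fin_numE negb_and !negbK => /orP[]/eqP->.
  by rewrite invr0 mulr0 divr_ge0 ?mulr_ge0 ?expR_ge0 ?fine_ge0// ltW.
have qD : q * expR (- (c * n%:R)) <= fine D by rewrite -lee_fin fineK.
have qe0 : 0 < q * expR (- (c * n%:R)) by rewrite mulr_gt0 ?expR_gt0.
have D0 : 0 < fine D by exact: lt_le_trans qe0 qD.
rewrite ler_pdivrMr// (le_trans _ (ler_wpM2l _ qD))//; last first.
  by rewrite divr_ge0 ?mulr_ge0 ?expR_ge0 ?fine_ge0// ltW.
rewrite (_ : _ / q * _ = expR (c1 * n%:R - c * n%:R) * fine (N n)); last first.
  by rewrite expRD; field; rewrite gt_eqF.
rewrite ler_wpM2r ?fine_ge0// ler_expR -mulrBl ler_wpM2r//.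
rewrite /c1 /c; lra.
Unshelve. all: by end_near.
Qed.

End splitting.
End posterior_asymptotics.

Theorem theorem3 (R : realType)
  (dX : measure_display) (X : measurableMetricType dX R)
  (sepX : separable X) (borelX : borel_sigma_algebra X)
  (lambda : {sigma_finite_measure set X -> \bar R})
  (dF : measure_display) (F : measurableType dF) (p : F -> X -> R)
  (p_density : density_family lambda p)
  (borelF : weak_borel lambda p)
  (p_joint : jointly_measurable p)
  (Pi : probability F R)
  (fstar : F) (Fstar : probability X R)
  (Fstar_density : has_density lambda Fstar (p fstar))
  (dO : measure_display) (Omega : measurableType dO) (P : probability Omega R)
  (xi : nat -> {RV P >-> X}) (xi_iid : iid Fstar xi)
  (beta : R) (beta_gt0 : 0 < beta)
  (bounded_model : beta_bounded xi Pi p fstar beta)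
  (KL_fstar : KL_support lambda Pi p fstar)
  (not_consistent : ~ hellinger_consistent xi lambda Pi p fstar) :
  exists alpha : R, 0 < alpha <= beta /\ inconsistent xi Pi p fstar alpha beta.
Proof.
apply: contrapT => nexists; apply: not_consistent => eps eps0.
pose alpha := Num.min beta (eps ^+ 2 / 2).
have alpha0 : 0 < alpha by rewrite lt_min beta_gt0 divr_gt0// exprn_gt0.
have [dens _] := p_density.
apply: (posterior_far_vanishes dens p_joint Fstar_density xi_iid
  (alpha := alpha) (beta := beta)) => //.
- by rewrite ge_min lexx orbT.
- move=> incons; apply: nexists; exists alpha; split => //.
  by rewrite alpha0 ge_min lexx.
Qed.
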